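(* Let $\Omega\subset\mathbb{R}^d$ be bounded, nonempty and open, let $f\in L^2(\Omega)$ and let $\gamma:\mathbb{R}^d\times\mathbb{R}^d\to[0,\infty)$ be measurable and symmetric. Then the homogeneous nonlocal Neumann problem $$\mathcal{L}u=f\ \text{ on }\Omega,\qquad \mathcal{N}u=0\ \text{ on }\Gamma,$$ has a weak solution if $$\int_\Omega f(x)\,dx=0$$ and if there is a constant $C>0$ such that for all $v\in\mathrm{V}(\Omega;\gamma)$ $$\int_\Omega\int_\Omega(v(x)-v(y))^2\,dy\,dx\le C\int_\Omega\int_{\mathbb{R}^d}(v(x)-v(y))^2\gamma(y,x)\,dy\,dx.$$ Furthermore, the weak solution is unique up to an additive constant.
   Context: Measurability is with respect to Lebesgue measure; symmetric means $\gamma(x,y)=\gamma(y,x)$. Let $\Gamma:=\{y\in\mathbb{R}^d\setminus\Omega:\int_\Omega\gamma(y,x)\,dx>0\}$. $\mathrm{V}(\Omega;\gamma)$ is the space of measurable $v:\mathbb{R}^d\to\mathbb{R}$ with $$\|v\|_{\mathrm{V}(\Omega;\gamma)}^2:=\int_\Omega v^2(x)\,dx+\int_\Omega\int_{\mathbb{R}^d}(v(x)-v(y))^2\gamma(y,x)\,dy\,dx<\infty,$$ functions agreeing a.e. on $\Omega\cup\Gamma$ being identified. On it let $$\mathfrak{B}(u,v):=\tfrac12\int_\Omega\int_\Omega(u(x)-u(y))(v(x)-v(y))\gamma(y,x)\,dy\,dx+\int_\Omega\int_\Gamma(u(x)-u(y))(v(x)-v(y))\gamma(y,x)\,dy\,dx.$$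 Here $\mathcal{L}u(x)=\int_{\mathbb{R}^d}(u(x)-u(y))\gamma(y,x)\,dy$ and $\mathcal{N}u(y)=\int_\Omega(u(y)-u(x))\gamma(y,x)\,dx$. A weak solution of the problem $\mathcal{L}u=f$ on $\Omega$, $\mathcal{N}u=0$ on $\Gamma$ is a function $u\in\mathrm{V}(\Omega;\gamma)$ with $$\int_\Omega f(x)v(x)\,dx=\mathfrak{B}(u,v)\quad\text{for all }v\in\mathrm{V}(\Omega;\gamma).$$ *)

(* Defs.v *)
From HB Require Import structures.
From mathcomp Require Import all_boot all_order all_algebra.
From mathcomp Require Import all_classical all_reals all_analysis.

Set Implicit Arguments.
Unset Strict Implicit.
Unset Printing Implicit Defensive.

Import Order.TTheory GRing.Theory Num.Theory.
Import numFieldNormedType.Exports.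

Local Open Scope classical_set_scope.
Local Open Scope ring_scope.

(* A copy of the space of row vectors, with the same normed structure (sup
   norm), whose measurable sets are the Lebesgue measurable sets. *)
Definition Rd (R : realType) (d : nat) : Type := 'rV[R]_d.

HB.instance Definition _ (R : realType) (d : nat) := NormedModule.on (Rd R d).

Definition box (R : realType) (d : nat) (p : Rd R d * Rd R d) : set (Rd R d) :=
  [set x | forall i, p.1 0 i < x 0 i <= p.2 0 i].

Definition box_volume (R : realType) (d : nat) (p : Rd R d * Rd R d) : R :=
  \prod_(i < d) Num.max 0 (p.2 0 i - p.1 0 i).

Local Open Scope ereal_scope.

(* The covering families are indexed by subsets of nat, so that finite and
   empty covers are allowed: for d = 0 there is no empty box to pad with. *)
Definition lebesgue_outer (R : realType) (d : nat) (X : set (Rd R d)) : \bar R :=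
  ereal_inf [set s | exists (K : set nat) (F : nat -> Rd R d * Rd R d),
    X `<=` \bigcup_(k in K) box (F k) /\
    s = \esum_(k in K) (box_volume (F k))%:E].

Section lebesgue_outer_measure.
Variables (R : realType) (d : nat).
Implicit Types (X : set (Rd R d)) (p : Rd R d * Rd R d).

Lemma box_volume_ge0 p : (0 <= box_volume p)%R.
Proof. by apply: prodr_ge0 => i _; rewrite le_max lexx. Qed.

Lemma lebesgue_outer_ge0 X : 0 <= lebesgue_outer X.
Proof.
apply: le_ereal_inf_tmp => _ [K [F [_ ->]]].
by apply: esum_ge0 => k _; rewrite lee_fin box_volume_ge0.
Qed.

Lemma lebesgue_outer0 : lebesgue_outer (@set0 (Rd R d)) = 0.
Proof.
apply/eqP; rewrite eq_le lebesgue_outer_ge0 andbT.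
apply: ereal_inf_lbound; exists set0, (fun=> (0%R, 0%R)); split => //.
by rewrite esum_set0.
Qed.

Lemma le_lebesgue_outer : {homo @lebesgue_outer R d : A B / A `<=` B >-> A <= B}.
Proof.
move=> A B AB; apply/ereal_inf_le_tmp => x [K [F [BF ->]]].
by exists K, F; split => //; apply: subset_trans AB BF.
Qed.

Lemma lebesgue_outer_sigma_subadditive :
  sigma_subadditive (@lebesgue_outer R d).
Proof.
move=> A; have [[i ioo]|] := pselect (exists i, lebesgue_outer (A i) = +oo).
  rewrite (eseries_pinfty _ _ ioo) ?leey// => n _.
  by rewrite -ltNye (lt_le_trans _ (lebesgue_outer_ge0 _)).
rewrite -forallNE => Aoo; apply/lee_addgt0Pr => e e0.
apply: le_trans (epsilon_trick _ _ (ltW e0)); last first.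
  by move=> n; exact: lebesgue_outer_ge0.
pose P n (KF : set nat * (nat -> Rd R d * Rd R d)) :=
  A n `<=` \bigcup_(k in KF.1) box (KF.2 k) /\
  \esum_(k in KF.1) (box_volume (KF.2 k))%:E <=
    lebesgue_outer (A n) + (e / (2 ^ n.+1)%:R)%:E.
have [G PG] : {G : nat -> set nat * (nat -> Rd R d * Rd R d) & forall n, P n (G n)}.
  apply: (@choice _ _ P) => n.
  have fin : lebesgue_outer (A n) \is a fin_num.
    by rewrite ge0_fin_numE ?lebesgue_outer_ge0// ltey; apply/eqP/Aoo.
  have en1 : (0 < e / (2 ^ n.+1)%:R)%R by rewrite divr_gt0.
  have [_ [K [F [AF ->]] /ltW KF]] := lb_ereal_inf_adherent en1 fin.
  by exists (K, F).
have /card_esym/ppcard_eqP[f] := card_nat2.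
pose Q : set (nat * nat) := [set: nat] `*`` (fun n => (G n).1).
pose v (q : nat * nat) : \bar R := (box_volume ((G q.1).2 q.2))%:E.
apply: (@le_trans _ _ (\esum_(q in Q) v q)).
  apply: ereal_inf_lbound; exists (f @^-1` Q), (fun k => (G (f k).1).2 (f k).2).
  split.
    move=> x [n _ /(PG n).1[k Kk Fx]]; exists (f^-1%FUN (n, k)).
      by rewrite /preimage/= invK ?inE.
    by rewrite invK ?inE.
  apply: (@reindex_esum R nat (nat * nat)%type (f @^-1` Q) Q f v).
  split.
  - by move=> k.
  - by move=> k l _ _ /(@inj _ _ _ f); apply; rewrite inE.
  - by move=> q Qq; exists (f^-1%FUN q); rewrite ?/preimage/= invK ?inE.
rewrite -(@esum_esum _ _ _ setT (fun n => (G n).1) (fun n k => v (n, k))); last first.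
  by move=> n k _ _; rewrite lee_fin box_volume_ge0.
rewrite nneseries_esumT; last first.
  by move=> n; rewrite adde_ge0 ?lebesgue_outer_ge0// lee_fin divr_ge0// ltW.
by apply: le_esum => n _; exact: (PG n).2.
Qed.

HB.instance Definition _ := isOuterMeasure.Build R (Rd R d)
  (@lebesgue_outer R d) lebesgue_outer0 lebesgue_outer_ge0 le_lebesgue_outer
  lebesgue_outer_sigma_subadditive.

HB.instance Definition _ :=
  @isMeasurable.Build (caratheodory_display (@lebesgue_outer R d)) (Rd R d)
    (caratheodory_measurable (@lebesgue_outer R d))
    (caratheodory_measurable_set0 _) (@caratheodory_measurable_setC _ _ _)
    (@caratheodory_measurable_bigcup _ _ _).

End lebesgue_outer_measure.

Definition lebesgue (R : realType) (d : nat) : set (Rd R d) -> \bar R :=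
  @lebesgue_outer R d.

HB.instance Definition _ (R : realType) (d : nat) :=
  isMeasure.Build _ _ _ (@lebesgue R d)
    (@caratheodory_measure0 R (Rd R d) (@lebesgue_outer R d))
    (@caratheodory_measure_ge0 R (Rd R d) (@lebesgue_outer R d))
    (@caratheodory_measure_sigma_additive R (Rd R d) (@lebesgue_outer R d)).

Section nonlocal.
Variables (R : realType) (d : nat).
Local Notation mu := (@lebesgue R d).
Implicit Types (Omega : set (Rd R d)) (gamma : Rd R d -> Rd R d -> R).
Implicit Types (f u v : Rd R d -> R).

(* Lebesgue measurability on R^d x R^d, viewed as R^(d + d). *)
Definition kernel_measurable gamma : Prop :=
  measurable_fun setT (fun z : Rd R (d + d) => gamma (lsubmx z) (rsubmx z)).

Definition L2 Omega f : Prop :=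
  measurable_fun Omega f /\ \int[mu]_(x in Omega) (f x ^+ 2)%:E < +oo.

Definition Gamma Omega gamma : set (Rd R d) :=
  [set y | ~ Omega y /\ 0 < \int[mu]_(x in Omega) (gamma y x)%:E].

Definition normV2 Omega gamma v : \bar R :=
  \int[mu]_(x in Omega) (v x ^+ 2)%:E +
  \int[mu]_(x in Omega) \int[mu]_y ((v x - v y) ^+ 2 * gamma y x)%:E.

(* Members of V are representatives; classes are taken modulo [eqV]. *)
Definition V Omega gamma v : Prop :=
  measurable_fun setT v /\ normV2 Omega gamma v < +oo.

Definition eqV Omega gamma u v : Prop :=
  {ae mu, forall x, (Omega `|` Gamma Omega gamma) x -> u x = v x}.

(* Extended-real valued, so that a divergent integral is not turned into 0. *)
Definition bilin Omega gamma u v : \bar R :=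
  (2^-1)%:E * \int[mu]_(x in Omega) \int[mu]_(y in Omega)
    ((u x - u y) * (v x - v y) * gamma y x)%:E +
  \int[mu]_(x in Omega) \int[mu]_(y in Gamma Omega gamma)
    ((u x - u y) * (v x - v y) * gamma y x)%:E.

Definition weak_solution Omega gamma f u : Prop :=
  V Omega gamma u /\
  forall v, V Omega gamma v ->
    \int[mu]_(x in Omega) (f x * v x)%:E = bilin Omega gamma u v.

End nonlocal.

(* Main.v *)
(* Write [I v] for the integral of [v] over [Omega].  By the Poincare
   inequality, [B (u, v) + I u * I v] is an inner product on V modulo null
   functions which controls the L^2(Omega) norm.  V is complete for it: along a
   fast Cauchy sequence both [v] and the increments [v x - v y] (weighted by the
   kernel) converge almost everywhere, and Fatou's lemma bounds the limit.  Hence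
   [v |-> int_Omega f v] is represented by some [u], and testing with [v = 1]
   gives [I u = 0] because [f] has mean zero, so [u] is a weak solution.  The
   difference of two solutions has zero energy; it is constant on [Omega] by the
   Poincare inequality, and takes the same value on Gamma because every point of
   Gamma interacts with a set of positive measure in [Omega].

   The kernel is only Lebesgue measurable on R^(2d), so Fubini's theorem is
   applied to a modification on a null set which is measurable for the product of
   the two Lebesgue sigma-algebras.  It exists because a Lebesgue measurable set
   is, up to a null set, a countable intersection of countable unions of boxes,
   and the product measure of a box is at most its volume. *)
Require Import Defs.
From HB Require Import structures.
From mathcomp Require Import all_boot all_order all_algebra.
From mathcomp Require Import all_classical all_reals all_analysis.
From mathcomp Require Import measurable_realfun ring lra.
Set Implicit Arguments.
Unset Strict Implicit.
Unset Printing Implicit Defensive.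
Import Order.TTheory GRing.Theory Num.Theory.
Import numFieldNormedType.Exports.
Local Open Scope classical_set_scope.
Local Open Scope ring_scope.

(** * Semidefinite forms and representation of bounded functionals *)

Section representation.
Variables (R : realType) (E : lmodType R) (V : set E) (B : E -> E -> R).
Hypothesis V0 : V 0.
Hypothesis VZD : forall a u v, V u -> V v -> V (a *: u + v).
Hypothesis Bsym : forall u v, V u -> V v -> B u v = B v u.
Hypothesis BZD : forall a u v w, V u -> V v -> V w ->
  B (a *: u + v) w = a * B u w + B v w.
Hypothesis B_ge0 : forall u, V u -> 0 <= B u u.

Lemma form_ZD a b u v : V u -> V v ->
  V (a *: u + b *: v) /\
  B (a *: u + b *: v) (a *: u + b *: v) =
    a ^+ 2 * B u u + 2 * a * b * B u v + b ^+ 2 * B v v.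
Proof.
move=> Vu Vv.
have Vbv : V (b *: v) by rewrite -[_ *: _]addr0; exact: VZD.
have Bv x : V x -> B (b *: v) x = b * B v x.
  have B0 : B 0 x = 0 -> V x -> B (b *: v) x = b * B v x.
    by move=> z Vx; rewrite -[_ *: _]addr0 BZD// z addr0.
  move=> Vx; apply: B0 => //.
  by have := BZD 1 V0 V0 Vx; rewrite scaler0 addr0 mul1r; lra.
have Vw := VZD a Vu Vbv; split=> //.
by rewrite BZD// Bv// (Bsym Vu)// (Bsym Vv)// !BZD// !Bv// (Bsym Vv)//; ring.
Qed.

Lemma form_cauchy_schwarz u v : V u -> V v -> B u v ^+ 2 <= B u u * B v v.
Proof.
move=> Vu Vv; have u0 := B_ge0 Vu; have v0 := B_ge0 Vv.
have h a b : 0 <= a ^+ 2 * B u u + 2 * a * b * B u v + b ^+ 2 * B v v.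
  by have [Vw <-] := form_ZD a b Vu Vv; exact: B_ge0.
have [Bv0|Bv0] := eqVneq (B v v) 0.
  rewrite Bv0 mulr0; have [->|uv] := eqVneq (B u v) 0; first by rewrite expr0n.
  (* With [B v v = 0] the quadratic is affine in [b]; at this [b] it takes the value -1, which
     contradicts [h]. *)
  have := h 1 (- (B u u + 1) / (2 * B u v)).
  have -> : 2 * 1 * (- (B u u + 1) / (2 * B u v)) * B u v = - (B u u + 1).
    by field.
  by rewrite Bv0 expr1n; lra.
have Bvp : 0 < B v v by rewrite lt_def Bv0.
(* The minimizing direction with denominators cleared: the quadratic factors as [B v v] times the
   Cauchy-Schwarz defect. *)
have := h (B v v) (- B u v).
have -> : B v v ^+ 2 * B u u + 2 * B v v * - B u v * B u v +
    (- B u v) ^+ 2 * B v v = B v v * (B u u * B v v - B u v ^+ 2) by ring.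
by rewrite pmulr_rge0// subr_ge0.
Qed.

Variables (F : E -> R) (K : R).
Hypothesis FZD : forall a u v, V u -> V v -> F (a *: u + v) = a * F u + F v.
Hypothesis F_bounded : forall v, V v -> F v ^+ 2 <= K * B v v.
Hypothesis V_complete : forall v : nat -> E, (forall n, V (v n)) ->
  (forall n m, (n <= m)%N -> B (v n - v m) (v n - v m) <= 16^-1 ^+ n) ->
  exists2 u, V u & B (v n - u) (v n - u) @[n --> \oo] --> 0.

(* The representer minimizes [B v v / 2 - F v]; the parallelogram identity
   makes every minimizing sequence Cauchy. *)
Lemma bounded_functional_representation :
  exists2 u, V u & forall v, V v -> F v = B u v.
Proof.
pose J v := B v v / 2 - F v.
have F0 : F 0 = 0.
  by have := FZD 1 V0 V0; rewrite scaler0 addr0 mul1r; lra.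
have FZ a v : V v -> F (a *: v) = a * F v.
  by move=> Vv; rewrite -[_ *: _]addr0 FZD// F0 addr0.
have Jge v : V v -> - (`|K| / 2) <= J v.
  (* By the arithmetic-geometric mean inequality, [F v] is at most half the sum of the absolute
     value of [K] and [B v v]. *)
  move=> Vv; have := B_ge0 Vv; have := F_bounded Vv; rewrite /J.
  have := ler_norm K; have := normr_ge0 K; move: (B v v) (F v) `|K| => b f k.
  move=> k0 Kk fk b0.
  have : f ^+ 2 <= ((k + b) / 2) ^+ 2.
    have := ler_wpM2r b0 Kk; have := sqr_ge0 (k - b).
    have -> : ((k + b) / 2) ^+ 2 = (k - b) ^+ 2 / 4 + k * b by field.
    by lra.
  have [f0|f0] := leP f 0; first by lra.
  by rewrite ler_sqr ?nnegrE; lra.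
have hi : has_inf [set J v | v in V].
  split; first by exists (J 0); exists 0.
  by exists (- (`|K| / 2)) => _ [v Vv <-]; exact: Jge.
set m := inf [set J v | v in V].
have Jm v : V v -> m <= J v by move=> Vv; apply: ge_inf; [case: hi|exists v].
(* The factor 1/8 matches the parallelogram identity: at the midpoint of [v n] and [v k], [J] lies
   below the mean of its two values by an eighth of [B (v n - v k) (v n - v k)]. *)
have e0 n : 0 < (16^-1 ^+ n : R) / 8 by rewrite divr_gt0// exprn_gt0// invr_gt0.
have /choice[v vP] n : exists v, V v /\ J v < m + 16^-1 ^+ n / 8.
  by have [_ [v Vv <-] ?] := inf_adherent (e0 n) hi; exists v.
have Vv n : V (v n) by case: (vP n).
have Jexp a b x y : V x -> V y -> V (a *: x + b *: y) /\
    J (a *: x + b *: y) = (a ^+ 2 * B x x + 2 * a * b * B x y + b ^+ 2 * B y y) / 2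
      - a * F x - b * F y.
  move=> Vx Vy; have [Vxy BE] := form_ZD a b Vx Vy; split => //.
  rewrite /J BE FZD// ?FZ//; first by ring.
  by rewrite -[_ *: _]addr0; exact: VZD.
have [|u Vu uP] := V_complete Vv.
  move=> n k nk.
  have -> : v n - v k = 1 *: v n + (- 1) *: v k by rewrite scale1r scaleN1r.
  rewrite (form_ZD 1 (- 1) (Vv n) (Vv k)).2.
  have [Vs] := Jexp 2^-1 2^-1 _ _ (Vv n) (Vv k).
  move: (Jm _ Vs) => /[swap] ->.
  have := (vP n).2; have := (vP k).2; rewrite /J.
  have : (16^-1 ^+ k : R) <= 16^-1 ^+ n.
    by apply: ler_wiXn2l => //; rewrite ?invf_le1 ?invr_ge0// ler1n.
  move: (16^-1 ^+ k : R) (16^-1 ^+ n : R) => ek en.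
  rewrite expr1n; lra.
exists u => // w Vw.
have Bw0 := B_ge0 Vw.
pose c n := B (v n) w - F w.
have Bvu n : V (v n - u) /\ B (v n - u) w = B (v n) w - B u w.
  rewrite addrC -scaleN1r; split; first exact: VZD.
  by rewrite BZD// mulN1r addrC.
have c_cvg : c n @[n --> \oo] --> B u w - F w.
  apply/cvgrPdist_le => e e_gt0.
  have d0 : 0 < e ^+ 2 / (B w w + 1) by rewrite divr_gt0 ?exprn_gt0//; lra.
  move/cvgrPdist_le : uP => /(_ _ d0); apply: filterS => n; rewrite sub0r normrN.
  have [Vvu eq] := Bvu n.
  rewrite ger0_norm ?B_ge0// => le.
  have -> : B u w - F w - c n = - B (v n - u) w by rewrite eq /c; ring.
  rewrite normrN -(@ler_pXn2r _ 2)// ?nnegrE ?normr_ge0 ?(ltW e_gt0)//.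
  rewrite real_normK ?num_real//.
  apply: le_trans (form_cauchy_schwarz Vvu Vw) _.
  apply: le_trans (ler_wpM2r Bw0 le) _.
  rewrite -mulrA ger_pMr ?exprn_gt0// mulrC ler_pdivrMr; lra.
(* First variation: [J] is at least [m] at [v n + t *: w], while [J (v n)] is below [m] plus the
   slack. *)
have cn n t : - (16^-1 ^+ n / 8) <= t * c n + t ^+ 2 * B w w / 2.
  have [Vs] := Jexp 1 t _ _ (Vv n) Vw; move: (Jm _ Vs) => /[swap] ->.
  have := (vP n).2; rewrite /J /c expr1n; lra.
have cl t : 0 <= t * (B u w - F w) + t ^+ 2 * B w w / 2.
  have l1 : (fun n => - (16^-1 ^+ n / 8 : R)) @ \oo --> - (0 / 8 : R).
    apply: cvgN; apply: cvgMl; apply: cvg_expr.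
    by rewrite ger0_norm ?invr_ge0// invf_lt1// ltr1n.
  have l2 : (fun n => t * c n + t ^+ 2 * B w w / 2) @ \oo -->
     t * (B u w - F w) + t ^+ 2 * B w w / 2.
    by apply: cvgD; [apply: cvgMr; exact: c_cvg|exact: cvg_cst].
  have := ler_lim (cvgP _ l1) (cvgP _ l2).
  rewrite (cvg_lim _ l1)// (cvg_lim _ l2)// mul0r oppr0; apply.
  by near=> n; exact: cn.
set d := B u w - F w in cl.
suff : d = 0 by rewrite /d; lra.
have b1 : 0 < B w w + 1 by lra.
(* The added 1 keeps the denominator positive when [B w w = 0]; the value at this [t] is a negative
   multiple of [d ^+ 2]. *)
have := cl (- d / (B w w + 1)).
have -> : - d / (B w w + 1) * d + (- d / (B w w + 1)) ^+ 2 * B w w / 2 =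
   - (d ^+ 2 * ((B w w + 2) / (2 * (B w w + 1) ^+ 2))).
  by field; lra.
rewrite oppr_ge0 pmulr_lle0 ?divr_gt0 ?mulr_gt0 ?exprn_gt0//; last by lra.
by move=> d2; apply/eqP; rewrite -sqrf_eq0 eq_le d2 sqr_ge0.
Unshelve. all: by end_near.
Qed.

End representation.

(** * Boxes, open sets and sigma-finiteness for Lebesgue measure *)

Section lebesgue_theory.
Variables (R : realType) (d : nat).
Local Notation mu := (@lebesgue R d).
Implicit Types (X : set (Rd R d)) (p : Rd R d * Rd R d).

Lemma lebesgue_le_cover X (K : set nat) (F : nat -> Rd R d * Rd R d) :
  X `<=` \bigcup_(k in K) box (F k) ->
  (mu X <= \esum_(k in K) (box_volume (F k))%:E)%E.
Proof. by move=> XF; apply: ereal_inf_lbound; exists K, F. Qed.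

Lemma lebesgue_cover_adherent X (e : R) : 0 < e -> mu X \is a fin_num ->
  exists (K : set nat) (F : nat -> Rd R d * Rd R d),
    X `<=` \bigcup_(k in K) box (F k) /\
    (\esum_(k in K) (box_volume (F k))%:E < mu X + e%:E)%E.
Proof.
by move=> e0 fX; have [_ [K [F [XF ->]]] ?] := lb_ereal_inf_adherent e0 fX;
  exists K, F.
Qed.

Lemma lebesgue_box_le p : (mu (box p) <= (box_volume p)%:E)%E.
Proof.
have := @lebesgue_le_cover (box p) [set 0%N] (fun=> p).
by rewrite esum_set1 ?lee_fin ?box_volume_ge0//; apply => x px; exists 0%N.
Qed.

(** The hyperplane cuts each covering box into two boxes whose volumes add up to its own, so a cover
    of [X] splits into covers of its two parts at no extra cost. A box on one side of the hyperplane
    leaves a degenerate piece, to which [Num.max 0] assigns volume 0. *)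
Lemma measurable_halfspace (i : 'I_d) (a : R) :
  measurable [set x : Rd R d | x 0 i <= a].
Proof.
apply: le_caratheodory_measurable => X /=.
apply: le_ereal_inf_tmp => _ [K [F [XF ->]]].
pose F1 k : Rd R d * Rd R d :=
  ((F k).1, \row_j if j == i then Num.min ((F k).2 0 j) a else (F k).2 0 j).
pose F2 k : Rd R d * Rd R d :=
  (\row_j if j == i then Num.max ((F k).1 0 j) a else (F k).1 0 j, (F k).2).
rewrite [leRHS](_ : _ = \esum_(k in K) (box_volume (F1 k))%:E +
    \esum_(k in K) (box_volume (F2 k))%:E)%E.
  apply: leeD; apply: lebesgue_le_cover => x [/XF[k Kk xF] xa];
    exists k => // j; have /andP[l r] := xF j; rewrite /= !mxE.
    by rewrite l; case: eqP => [->|]//; rewrite le_min xa andbT; have /andP[] := xF i.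
  rewrite r andbT; case: eqP => [->|]//; rewrite gt_max.
  by have /andP[-> _] := xF i; rewrite /= ltNge; exact/negP.
rewrite -esumD; try by move=> *; rewrite lee_fin box_volume_ge0.
apply: eq_esum => k _; rewrite -EFinD; congr EFin.
pose c (p : Rd R d * Rd R d) j := Num.max 0 (p.2 0 j - p.1 0 j).
have volE p : box_volume p = c p i * \prod_(j < d | j != i) c p j.
  by rewrite /box_volume (bigD1 i).
have c1 : \prod_(j < d | j != i) c (F1 k) j = \prod_(j < d | j != i) c (F k) j.
  by apply: eq_bigr => j /negbTE ji; rewrite /c /= !mxE ji.
have c2 : \prod_(j < d | j != i) c (F2 k) j = \prod_(j < d | j != i) c (F k) j.
  by apply: eq_bigr => j /negbTE ji; rewrite /c /= !mxE ji.
rewrite !volE c1 c2 -mulrDl /c /= !mxE eqxx; congr (_ * _).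
move: ((F k).1 0 i) ((F k).2 0 i) => p q.
case: (leP q a) => ?; case: (leP p a) => ?; case: (leP 0 (q - p)) => ?;
  by case: (leP 0 (a - p)) => ?; case: (leP 0 (q - a)) => ?; lra.
Qed.

Lemma measurable_box p : measurable (box p).
Proof.
rewrite (_ : box p = \bigcap_(i in [set: 'I_d])
    ([set x : Rd R d | x 0 i <= p.2 0 i] `&` ~` [set x : Rd R d | x 0 i <= p.1 0 i])).
  apply: fin_bigcap_measurable => // i _; apply: measurableI.
    exact: measurable_halfspace.
  by apply: measurableC; exact: measurable_halfspace.
apply/seteqP; split => x /=.
  by move=> px i _ /=; have /andP[l r] := px i; split => //; apply/negP; rewrite -ltNge.
move=> px i; have [/= -> /negP] := px i I.
by rewrite -ltNge => ->.
Qed.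

(** An open set is the union of the boxes with rational corners that it contains, and there are
    countably many of these. *)
Lemma open_measurable_Rd (U : set (Rd R d)) : open U -> measurable U.
Proof.
move=> oU.
pose rbox (q : 'rV[rat]_d * 'rV[rat]_d) : set (Rd R d) :=
  box (map_mx ratr q.1, map_mx ratr q.2).
rewrite (_ : U = \bigcup_(q in setT) if `[< rbox q `<=` U >] then rbox q else set0).
  apply: countable_bigcupT_measurable => // q.
  by case: ifPn => _; [exact: measurable_box|exact: measurable0].
apply/seteqP; split => [x Ux|x [q _]]; last by case: asboolP => // qU /qU.
have /nbhs_ballP[e /= e0 xe] : nbhs x U by rewrite nbhsE; exists U.
have /choice[p pP] i : exists p : rat, ratr p \in `](x 0 i - e), (x 0 i)[.
  by apply: rat_in_itvoo; rewrite ltrBlDr ltrDl.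
have /choice[q qP] i : exists q : rat, ratr q \in `](x 0 i), (x 0 i + e)[.
  by apply: rat_in_itvoo; rewrite ltrDl.
exists (\row_i p i, \row_i q i) => //.
case: asboolP => [_ i|[]].
  rewrite /= !mxE; have := pP i; have := qP i; rewrite !in_itv/=.
  by move=> /andP[/ltW -> _] /andP[_ ->].
move=> y yb; apply: xe; split => // i j; rewrite (ord1 i) /ball /=.
have := yb j; rewrite /= !mxE; have := pP j; have := qP j; rewrite !in_itv/=.
move: (x 0 j) (y 0 j) => a b; rewrite ltr_norml.
by move=> /andP[? ?] /andP[? ?] /andP[? ?]; apply/andP; lra.
Qed.

Let cube (n : nat) : Rd R d * Rd R d := (const_mx (- n%:R), const_mx n%:R).

Lemma lebesgue_bounded_lty (A : set (Rd R d)) : bounded_set A -> (mu A < +oo)%E.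
Proof.
move=> [M [_ /(_ (M + 1))]]; rewrite ltrDl => /(_ ltr01) AM.
have [n Mn] : exists n : nat, M + 1 < n%:R.
  exists (Num.bound `|M + 1|).
  by apply: le_lt_trans (ler_norm _) _; exact: archi_boundP.
apply: (@le_lt_trans _ _ (mu (box (cube n)))).
  apply: le_lebesgue_outer => x /AM xM i; rewrite /= !mxE.
  have : `|x 0 i| < n%:R.
    apply: le_lt_trans Mn; apply: le_trans xM.
    rewrite [leRHS]mx_normrE; exact: (le_bigmax _ (fun i => `|x i.1 i.2|) (0, i)).
  by rewrite ltr_norml => /andP[-> /ltW].
exact: le_lt_trans (lebesgue_box_le _) (ltry _).
Qed.

Lemma lebesgue_sigma_finite : sigma_finite setT mu.
Proof.
exists (fun n => box (cube n)).
  apply/esym/seteqP; split => // x _; exists (Num.bound `|x|) => // i.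
  rewrite /= !mxE.
  suff : `|x 0 i| < (Num.bound `|x|)%:R by rewrite ltr_norml => /andP[-> /ltW].
  apply: le_lt_trans (archi_boundP _) => //.
  rewrite [leRHS]mx_normrE; exact: (le_bigmax _ (fun i => `|x i.1 i.2|) (0, i)).
move=> n; split; first exact: measurable_box.
exact: le_lt_trans (lebesgue_box_le _) (ltry _).
Qed.

End lebesgue_theory.

HB.instance Definition _ (R : realType) (d : nat) :=
  Measure_isSigmaFinite.Build _ _ _ (@lebesgue R d) (lebesgue_sigma_finite R d).

(** * Lebesgue measurability on pairs versus the product sigma-algebra *)

Section lebesgue_pair.
Variables (R : realType) (d : nat).
Local Notation mu := (@lebesgue R d).
Local Notation pi := (mu \x mu)%E.

Definition pair_row (z : Rd R d * Rd R d) : Rd R (d + d) :=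
  row_mx (z.1 : 'rV_d) (z.2 : 'rV_d).

Definition lbox (p : Rd R (d + d) * Rd R (d + d)) : Rd R d * Rd R d :=
  (lsubmx (p.1 : 'rV_(d + d)), lsubmx (p.2 : 'rV_(d + d))).

Definition rbox (p : Rd R (d + d) * Rd R (d + d)) : Rd R d * Rd R d :=
  (rsubmx (p.1 : 'rV_(d + d)), rsubmx (p.2 : 'rV_(d + d))).

Lemma pair_row_box p : pair_row @^-1` box p = box (lbox p) `*` box (rbox p).
Proof.
apply/seteqP; split => [z zp|z [zl zr] i].
  by split => i; rewrite /= !mxE;
    [have := zp (lshift d i)|have := zp (rshift d i)];
    rewrite /= ?row_mxEl ?row_mxEr.
by rewrite -(splitK i); case: (fintype.split i) => j /=;
  [have := zl j|have := zr j]; rewrite /= ?row_mxEl ?row_mxEr !mxE.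
Qed.

Lemma measurable_pair_row_box p : measurable (pair_row @^-1` box p).
Proof. by rewrite pair_row_box; apply: measurableX; exact: measurable_box. Qed.

Lemma pair_row_box_le p : (pi (pair_row @^-1` box p) <= (box_volume p)%:E)%E.
Proof.
rewrite pair_row_box product_measure1E; try exact: measurable_box.
rewrite (_ : box_volume p = box_volume (lbox p) * box_volume (rbox p)).
  by rewrite EFinM; apply: lee_pmul => //; exact: lebesgue_box_le.
by rewrite /box_volume big_split_ord/=; congr (_ * _); apply: eq_bigr => i _;
  rewrite !mxE.
Qed.

Section cover.
Variables (K : set nat) (F : nat -> Rd R (d + d) * Rd R (d + d)).

Lemma measurable_pair_row_cover :
  measurable (pair_row @^-1` \bigcup_(k in K) box (F k)).
Proof.
rewrite preimage_bigcup; apply: bigcup_measurable => k _.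
exact: measurable_pair_row_box.
Qed.

Lemma pair_row_cover_le : (pi (pair_row @^-1` \bigcup_(k in K) box (F k)) <=
  \esum_(k in K) (box_volume (F k))%:E)%E.
Proof.
(* Indices outside [K] contribute the empty set, so that subadditivity over all of [nat] applies. *)
pose A k := if k \in K then pair_row @^-1` box (F k) else set0.
apply: (@le_trans _ _ (\sum_(k <oo) pi (A k))%E).
  apply: measure_sigma_subadditive.
  - move=> k; rewrite /A; case: ifPn => _ //; exact: measurable_pair_row_box.
  - exact: measurable_pair_row_cover.
  - by move=> x [k Kk xk]; exists k => //; rewrite /A mem_set.
rewrite nneseries_esumT; last by move=> k; exact: measure_ge0.
rewrite [leRHS]esum_mkcond; apply: le_esum => k _; rewrite /A.
by case: ifPn => _; rewrite ?measure0//; exact: pair_row_box_le.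
Qed.

End cover.

(** Covers of [N] by boxes of total volume below [1 / (n + 1)] pull back to product-measurable sets
    of at most that measure; their intersection over [n] is the required null set. *)
Lemma pair_row_null (N : set (Rd R (d + d))) :
  @lebesgue R (d + d) N = 0%E -> pi.-negligible (pair_row @^-1` N).
Proof.
move=> N0.
have /choice[Z ZP] n : exists Z, [/\ measurable Z, pair_row @^-1` N `<=` Z &
    (pi Z <= (n.+1%:R^-1)%:E)%E].
  have n0 : (0 : R) < n.+1%:R^-1 by rewrite invr_gt0.
  have fN : @lebesgue R (d + d) N \is a fin_num by rewrite N0.
  have [K [F [NF /ltW]]] := lebesgue_cover_adherent n0 fN.
  rewrite N0 add0e => le; eexists; split; first exact: (measurable_pair_row_cover K F).
    by move=> z /NF.
  exact: le_trans (pair_row_cover_le K F) le.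
exists (\bigcap_n Z n); split.
- by apply: bigcapT_measurable => n; case: (ZP n).
- apply/eqP; rewrite eq_le measure_ge0 andbT; apply/lee_addgt0Pr => e e0.
  rewrite add0e; have [n ne] : exists n, n.+1%:R^-1 < e.
    exists (Num.bound e^-1); rewrite invf_plt ?posrE//.
    apply: lt_trans (archi_boundP _) _; first by rewrite invr_ge0 ltW.
    by rewrite ltr_nat.
  have [mZ _ le] := ZP n.
  apply: (@le_trans _ _ (pi (Z n))).
    apply: le_measure; rewrite ?inE//; last by move=> x /(_ n I).
    by apply: bigcapT_measurable => k; case: (ZP k).
  by apply: le_trans le _; rewrite lee_fin ltW.
- by move=> z Nz n _; have [_ + _] := ZP n; apply.
Qed.

(** Membership in the completion of the product sigma-algebra, phrased by deleting a null set so
    that countable unions are easy. *)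
Definition pair_measurable (S : set (Rd R d * Rd R d)) := exists Z,
  [/\ measurable Z, pi Z = 0%E & measurable (S `\` Z)].

Lemma pair_measurable_bigcup (S : nat -> set (Rd R d * Rd R d)) :
  (forall n, pair_measurable (S n)) -> pair_measurable (\bigcup_n S n).
Proof.
move=> /choice[Z ZP].
have mZ n : measurable (Z n) by case: (ZP n).
exists (\bigcup_n Z n); split; first exact: bigcupT_measurable.
  apply: measure_negligible; first exact: bigcupT_measurable.
  by apply: negligible_bigcup => n; apply/negligibleP => //; case: (ZP n).
rewrite (_ : _ `\` _ = \bigcup_n (S n `\` Z n) `\` \bigcup_n Z n).
  apply: measurableD; apply: bigcupT_measurable => // n; by case: (ZP n).
apply/seteqP; split => [z [[n _ Sz] nZ]|z [[n _ [Sz _]] nZ]]; last first.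
  by split => //; exists n.
by split => //; exists n => //; split => // Zz; apply: nZ; exists n.
Qed.

(* A Lebesgue measurable set of finite measure is a countable intersection of
   countable unions of boxes minus a null set. *)
Lemma pair_row_measurable_fin (A : set (Rd R (d + d))) : measurable A ->
  (@lebesgue R (d + d) A < +oo)%E -> pair_measurable (pair_row @^-1` A).
Proof.
move=> mA Aoo.
have fA : @lebesgue R (d + d) A \is a fin_num by rewrite ge0_fin_numE.
have /choice[G GP] n : exists G, [/\ measurable G, A `<=` G,
    measurable (pair_row @^-1` G) &
    (@lebesgue R (d + d) G <= lebesgue A + (n.+1%:R^-1)%:E)%E].
  have n0 : (0 : R) < n.+1%:R^-1 by rewrite invr_gt0.
  have [K [F [AF /ltW le]]] := lebesgue_cover_adherent n0 fA.
  exists (\bigcup_(k in K) box (F k)); split => //.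
  - by apply: bigcup_measurable => k _; exact: measurable_box.
  - exact: measurable_pair_row_cover.
  - by apply: le_trans le; exact: lebesgue_le_cover.
pose G' := \bigcap_n G n.
have mG' : measurable G' by apply: bigcapT_measurable => n; case: (GP n).
have AG' : A `<=` G' by move=> z Az n _; have [_ + _ _] := GP n; apply.
have G'A : (@lebesgue R (d + d) G' <= lebesgue A)%E.
  apply/lee_addgt0Pr => e e0; have [n ne] : exists n, n.+1%:R^-1 < e.
    exists (Num.bound e^-1); rewrite invf_plt ?posrE//.
    apply: lt_trans (archi_boundP _) _; first by rewrite invr_ge0 ltW.
    by rewrite ltr_nat.
  have [_ _ _ le] := GP n; apply: (@le_trans _ _ (@lebesgue R (d + d) (G n))).
    by apply: le_lebesgue_outer => x /(_ n I).
  by apply: le_trans le _; rewrite leeD2l// lee_fin ltW.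
have G'0 : @lebesgue R (d + d) (G' `\` A) = 0%E.
  have GA : @lebesgue R (d + d) G' = lebesgue A.
    by apply/eqP; rewrite eq_le G'A; exact: le_lebesgue_outer.
  have Goo : (@lebesgue R (d + d) G' < +oo)%E by rewrite GA.
  by rewrite (measureD mG' mA Goo) setIidr// [X in (X - _)%E]GA subee.
have [Z [mZ Z0 GZ]] := pair_row_null G'0.
exists Z; split => //.
(* [Z] covers the pullback of the null gap between [G'] and [A], so off [Z] the two pullbacks
   coincide. *)
rewrite (_ : _ `\` _ = pair_row @^-1` G' `\` Z).
  apply: measurableD => //; rewrite preimage_bigcap; apply: bigcapT_measurable => n.
  by case: (GP n).
apply/seteqP; split => z [zA nZ]; split => //; first exact: AG'.
by apply: contrapT => nA; apply: nZ; apply: GZ.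
Qed.

Lemma pair_row_measurable (A : set (Rd R (d + d))) : measurable A ->
  pair_measurable (pair_row @^-1` A).
Proof.
move=> mA; have [F FT FP] := lebesgue_sigma_finite R (d + d).
rewrite -(setIT A) FT setI_bigcupr preimage_bigcup.
apply: pair_measurable_bigcup => n; have [mF Foo] := FP n.
apply: pair_row_measurable_fin; first exact: measurableI.
by apply: le_lt_trans Foo; apply: le_lebesgue_outer.
Qed.

(** Each superlevel set at a rational level is measurable off a null set. The union [N] of these
    null sets serves every real level [r], as the set where [r < gamma] is the union of those for
    rational levels at least [r]. *)
Lemma kernel_measurable_pair (gamma : Rd R d -> Rd R d -> R) :
  kernel_measurable gamma -> (forall x y, 0 <= gamma x y) ->
  exists Z, [/\ measurable Z, pi Z = 0%E &
    measurable_fun setT (fun z => gamma z.1 z.2 * \1_(~` Z) z)].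
Proof.
move=> mg g0; pose A (r : R) := [set z | r < gamma z.1 z.2].
have /choice[Z ZP] (q : rat) : exists Z,
    [/\ measurable Z, pi Z = 0%E & measurable (A (ratr q) `\` Z)].
  have := mg measurableT _ (measurable_itv `](ratr q), +oo[).
  rewrite setTI => /pair_row_measurable[Z [mZ Z0 mA]]; exists Z; split => //.
  rewrite (_ : A _ = pair_row @^-1` ((fun z : Rd R (d + d) =>
    gamma (lsubmx z) (rsubmx z)) @^-1` `](ratr q), +oo[)) //.
  by apply/seteqP; split => -[x y]; rewrite /A /= in_itv/= andbT row_mxKl row_mxKr.
pose N := \bigcup_q Z q.
have mN : measurable N by apply: bigcupT_measurable_rat => q; case: (ZP q).
have mAN r : measurable (A r `\` N).
  rewrite (_ : _ `\` _ =
    \bigcup_q (if r <= ratr q then (A (ratr q) `\` Z q) `\` N else set0)).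
    apply: bigcupT_measurable_rat => q; case: ifPn => // _.
    by apply: measurableD => //; case: (ZP q).
  apply/seteqP; split => [z [rz nN]|z [q _]].
    have [q] : exists q : rat, ratr q \in `]r, (gamma z.1 z.2)[.
      exact: rat_in_itvoo.
    rewrite in_itv/= => /andP[rq qz].
    exists q => //; rewrite (ltW rq); split => //; split => // Zz; apply: nN.
    by exists q.
  by case: ifPn => // rq [[qz _] nN]; split => //; exact: le_lt_trans qz.
exists N; split => //.
  apply: measure_negligible => //; rewrite /N.
  have /card_esym/ppcard_eqP[f] := card_rat.
  rewrite (reindex_bigcup f setT) //.
  by apply: negligible_bigcup => n; have [mZ Z0 _] := ZP (f n); exact/negligibleP.
apply: (measurability _ (RGenOInfty.measurableE R)) => // _ [_ [r ->] <-].
(* The modified kernel is 0 on [N], so for [0 <= r] no point of [N] exceeds [r], and for [r < 0]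
   every point does. *)
rewrite setTI; have [r0|r0] := leP 0 r.
  rewrite (_ : _ @^-1` _ = A r `\` N) //.
  apply/seteqP; split => z /=; rewrite in_itv/= andbT indicE.
    case: (boolP (z \in ~` N)) => [/set_mem nN|_]; first by rewrite mulr1.
    by rewrite mulr0 ltNge r0.
  by move=> [rz nN]; rewrite mem_set// mulr1.
rewrite (_ : _ @^-1` _ = setT) //; apply/seteqP; split => // z _.
by rewrite /= in_itv/= andbT (lt_le_trans r0)// mulr_ge0.
Qed.

End lebesgue_pair.

(** * Almost everywhere equality under the integral *)

Section ae_eq_integral_any.
Context {d : measure_display} {T : measurableType d} {R : realType}.
Variable m : {measure set T -> \bar R}.
Local Open Scope ereal_scope.
Import HBNNSimple.

(** The integral is a supremum over simple functions. One lying below [f], set to 0 on the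
    exceptional null set, lies below [g] and keeps its integral. *)
Let ge0_le_integral_ae (f g : T -> \bar R) : (forall x, 0 <= f x) ->
  (forall x, 0 <= g x) -> {ae m, forall x, f x = g x} ->
  \int[m]_x f x <= \int[m]_x g x.
Proof.
move=> f0 g0 [N [mN N0 fgN]].
rewrite ge0_integralTE//; apply: ge_ereal_sup => _ [h hf <-].
pose h' := mul_nnsfun h (indic_nnsfun R (measurableC mN)).
have h'E x : h' x = (h x * \1_(~` N) x)%R by [].
have h'g x : (h' x)%:E <= g x.
  rewrite h'E indicE; case: (boolP (x \in ~` N)) => [/set_mem nN|_].
    rewrite mulr1; have <- : f x = g x by apply: contrapT => fg; apply: nN; exact: fgN.
    exact: hf.
  by rewrite mulr0.
rewrite -integralT_nnsfun (@ge0_ae_eq_integral _ _ _ _ _ _ (EFin \o h')) //.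
- by rewrite integralT_nnsfun ge0_integralTE//; apply: ereal_sup_ubound; exists h'.
- exact/measurable_EFinP.
- exact/measurable_EFinP.
- by move=> x _; rewrite lee_fin.
- by move=> x _; rewrite lee_fin.
exists N; split => // x hx; apply: contrapT => nN; apply: hx => _.
by rewrite -[RHS]/((h' x)%:E) h'E indicE mem_set// mulr1.
Qed.

(* The sections of a Lebesgue measurable kernel are measurable only almost
   everywhere, so no measurability is required here. *)
Lemma ae_eq_integral_any (D : set T) (f g : T -> \bar R) :
  {ae m, forall x, D x -> f x = g x} ->
  \int[m]_(x in D) f x = \int[m]_(x in D) g x.
Proof.
move=> fg; rewrite integral_mkcond [RHS]integral_mkcond.
have {}fg : {ae m, forall x, (f \_ D) x = (g \_ D) x}.
  apply: filterS fg => x fgx; rewrite !patchE.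
  by case: ifPn => // /set_mem/fgx.
rewrite integralE [RHS]integralE; congr (_ - _); apply/eqP; rewrite eq_le.
- apply/andP; split; apply: ge0_le_integral_ae => //;
    by apply: filterS fg => x; rewrite !funeposE => ->.
- apply/andP; split; apply: ge0_le_integral_ae => //;
    by apply: filterS fg => x; rewrite !funenegE => ->.
Qed.

End ae_eq_integral_any.

(** * Weighted square-integrable functions and their almost everywhere limits *)

Lemma cvg_of_fast_increments (R : realType) (a : nat -> R) (M : R) :
  (forall n, 4 ^+ n * (a n.+1 - a n) ^+ 2 <= M) -> cvgn a.
Proof.
move=> aM.
have M0 : 0 <= M by apply: le_trans (aM 0%N); rewrite mulr_ge0 ?sqr_ge0.
(* Taking square roots gives geometric decay with ratio 1/2, so the telescoping series converges
   absolutely. *)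
have le n : `|a n.+1 - a n| <= Num.sqrt M * 2^-1 ^+ n.
  rewrite -(@ler_pXn2r _ 2)// ?nnegrE ?mulr_ge0 ?sqrtr_ge0 ?exprn_ge0//.
  rewrite real_normK ?num_real// exprMn sqr_sqrtr// -exprM mulnC exprM.
  rewrite (_ : 2^-1 ^+ 2 = 4^-1); last by field.
  by rewrite exprVn ler_pdivlMr ?exprn_gt0// mulrC.
have cD : cvgn (series (fun n => a n.+1 - a n)).
  apply: normed_cvg.
  apply: (@series_le_cvg _ (fun n => `|a n.+1 - a n|)
    (geometric (Num.sqrt M) 2^-1)) => //.
  - by move=> n; rewrite mulr_ge0 ?sqrtr_ge0 ?exprn_ge0.
  - by apply: is_cvg_geometric_series; rewrite ger0_norm ?invf_lt1// ltr1n.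
have -> : a = (fun n => a 0%N + series (fun n => a n.+1 - a n) n).
  by apply/funext => n; rewrite /series/= telescope_sumr// addrC subrK.
by apply: is_cvgD => //; exact: is_cvg_cst.
Qed.

Section weighted_form.
Context {d : measure_display} {T : measurableType d} {R : realType}.
Variables (m : {measure set T -> \bar R}) (k : T -> R).
Hypotheses (mk : measurable_fun setT k) (k0 : forall x, 0 <= k x).

(** One weighted theory serves twice: with an indicator as weight for functions on the domain, and
    with a kernel as weight for increments on pairs. The extended value expresses finiteness; the
    algebra is done with the real-valued [wform]. *)
Definition wsq (a : T -> R) : \bar R := (\int[m]_x (a x ^+ 2 * k x)%:E)%E.

Lemma wsq_subC (a b : T -> R) :
  wsq (fun x => a x - b x) = wsq (fun x => b x - a x).
Proof. by apply: eq_integral => x _; congr (_ * _)%:E; ring. Qed.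

Definition wL2 : set (T -> R) :=
  [set a | measurable_fun setT a /\ (wsq a < +oo)%E].

Definition wform (a b : T -> R) : R := \int[m]_x (a x * b x * k x).

Lemma measurable_wsq (a : T -> R) : measurable_fun setT a ->
  measurable_fun setT (fun x => (a x ^+ 2 * k x)%:E).
Proof.
by move=> ma; apply/measurable_EFinP; apply: measurable_funM => //;
  exact: measurable_funX.
Qed.

Lemma wsq_ge0 a : (0 <= wsq a)%E.
Proof. by apply: integral_ge0 => x _; rewrite lee_fin mulr_ge0 ?sqr_ge0. Qed.

Lemma wL2_sq_integrable a : wL2 a ->
  m.-integrable setT (EFin \o (fun x => a x ^+ 2 * k x)).
Proof.
move=> [ma aoo]; apply/integrableP; split; first exact: measurable_wsq.
apply: le_lt_trans aoo; rewrite le_eqVlt; apply/orP; left; apply/eqP.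
by apply: eq_integral => x _; rewrite /= ger0_norm// mulr_ge0// sqr_ge0.
Qed.

Lemma wL2_integrable a b : wL2 a -> wL2 b ->
  m.-integrable setT (EFin \o (fun x => a x * b x * k x)).
Proof.
move=> Wa Wb; have := integrableD measurableT (wL2_sq_integrable Wa)
  (wL2_sq_integrable Wb).
apply: le_integrable => //.
  apply/measurable_EFinP; apply: measurable_funM => //; apply: measurable_funM.
    by case: Wa.
  by case: Wb.
move=> x _ /=; rewrite lee_fin !normrM (ger0_norm (k0 x)).
rewrite -mulrDl; apply: le_trans (ler_norm _); apply: ler_wpM2r => //.
have := sqr_ge0 (`|a x| - `|b x|).
by rewrite -(real_normK (num_real (a x))) -(real_normK (num_real (b x))); nra.
Qed.

Lemma wL2_ZD t a b : wL2 a -> wL2 b -> wL2 (fun x => t * a x + b x).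
Proof.
move=> Wa Wb; have mab : measurable_fun setT (fun x => t * a x + b x).
  apply: measurable_funD; last by case: Wb.
  by apply: measurable_funM => //; case: Wa.
split=> //.
have /integrableP[mg] := integrableD measurableT
  (integrableZl measurableT (2 * t ^+ 2) (wL2_sq_integrable Wa))
  (integrableZl measurableT 2 (wL2_sq_integrable Wb)).
apply: le_lt_trans; apply: ge0_le_integral => //.
- by move=> x _; rewrite lee_fin mulr_ge0 ?sqr_ge0.
- exact: measurable_wsq.
- exact: measurableT_comp.
move=> x _ /=; rewrite lee_fin; apply: le_trans (ler_norm _).
rewrite !mulrA -mulrDl; apply: ler_wpM2r => //.
by have := sqr_ge0 (t * a x - b x); nra.
Qed.

Lemma wL20 : wL2 (fun=> 0).
Proof.
split=> //; rewrite /wsq (eq_integral (cst 0%E)) ?integral0// => x _.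
by rewrite expr0n mul0r.
Qed.

Lemma wformC a b : wform a b = wform b a.
Proof. by apply: eq_Rintegral => x _; rewrite [_ * b x]mulrC. Qed.

Lemma wformZD t a b c : wL2 a -> wL2 b -> wL2 c ->
  wform (fun x => t * a x + b x) c = t * wform a c + wform b c.
Proof.
move=> Wa Wb Wc.
rewrite /wform -RintegralZl//; last exact: wL2_integrable.
rewrite -RintegralD//; last 2 first.
- exact: integrableZl (wL2_integrable Wa Wc).
- exact: wL2_integrable.
by apply: eq_Rintegral => x _; ring.
Qed.

Lemma wsqE a : wL2 a -> wsq a = (wform a a)%:E.
Proof.
move=> Wa; rewrite /wform /Rintegral fineK; last first.
  by apply: integrable_fin_num => //; exact: wL2_integrable.
by apply: eq_integral => x _; rewrite expr2.
Qed.

Lemma wform_ge0 a : wL2 a -> 0 <= wform a a.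
Proof. by move=> Wa; rewrite -lee_fin -wsqE// wsq_ge0. Qed.

Lemma wform_eq0_ae a : wL2 a -> wform a a = 0 ->
  {ae m, forall x, a x ^+ 2 * k x = 0}.
Proof.
move=> Wa aa0; have mE := measurable_wsq Wa.1.
have : (\int[m]_x `|(a x ^+ 2 * k x)%:E| = 0)%E.
  rewrite -[RHS](congr1 EFin aa0) -wsqE//; apply: eq_integral => x _.
  by rewrite gee0_abs// lee_fin mulr_ge0// sqr_ge0.
move/(ae_eq_integral_abs m measurableT mE); apply: filterS => x /(_ I) /=.
by move=> [].
Qed.

(** Fatou's lemma for the squared differences. Where the weight vanishes the integrand is 0 whatever
    the sequence does, hence the alternative [k x = 0]. *)
Lemma wsq_fatou (a : nat -> T -> R) (b c : T -> R) (C : \bar R) :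
  (forall n, measurable_fun setT (a n)) -> measurable_fun setT b ->
  measurable_fun setT c ->
  {ae m, forall x, k x = 0 \/ a n x @[n --> \oo] --> b x} ->
  (\forall n \near \oo, (wsq (fun x => c x - a n x)%R <= C)%E) ->
  (wsq (fun x => c x - b x)%R <= C)%E.
Proof.
move=> ma mb mc ab aC.
have mca n : measurable_fun setT (fun x => ((c x - a n x) ^+ 2 * k x)%:E).
  by apply: measurable_wsq; exact: measurable_funB.
rewrite /wsq (ae_eq_integral_any (g := fun x =>
  limn_einf (fun n => ((c x - a n x) ^+ 2 * k x)%:E))); last first.
  apply: filterS ab => x abx _; apply/esym.
  suff /cvg_limn_einf_sup[] : ((c x - a n x) ^+ 2 * k x)%:E @[n --> \oo] -->
      ((c x - b x) ^+ 2 * k x)%:E by [].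
  case: abx => [kx|abx].
    rewrite kx mulr0; under eq_fun do rewrite mulr0.
    exact: cvg_cst.
  apply: cvg_EFin; first by near=> n.
  apply: cvgMl; under eq_fun do rewrite expr2.
  by rewrite expr2; apply: cvgM; apply: cvgB => //; exact: cvg_cst.
have f0 n x : setT x -> (0 <= ((c x - a n x) ^+ 2 * k x)%:E)%E.
  by move=> _; rewrite lee_fin mulr_ge0 ?sqr_ge0.
apply: le_trans (fatou m measurableT mca f0) _.
have [N _ NC] := aC; rewrite limn_einf_lim; apply: lime_le.
  exact: is_cvg_einfs.
exists N => // n /= Nn; apply: le_trans (NC n Nn).
by apply: ereal_inf_lbound; exists n => /=.
Unshelve. all: by end_near.
Qed.

(** Even after multiplication by [4 ^+ n] the weighted squared increments have summable integrals,
    since 4/16 = 1/4. Their sum is thus finite almost everywhere and bounds each of its terms;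
    dividing by a nonzero [k x] gives pointwise fast increments. *)
Lemma wL2_fast_cauchy_cvg (a : nat -> T -> R) (C : R) :
  (forall n, measurable_fun setT (a n)) ->
  (forall n, (wsq (fun x => a n.+1 x - a n x)%R <= (C * 16^-1 ^+ n)%:E)%E) ->
  {ae m, forall x, k x = 0 \/ cvgn (fun n => a n x)}.
Proof.
move=> ma aC.
pose h n x : \bar R := ((4 ^+ n)%:E * ((a n.+1 x - a n x) ^+ 2 * k x)%:E)%E.
have mD n : measurable_fun setT (fun x => ((a n.+1 x - a n x) ^+ 2 * k x)%:E).
  by apply: measurable_wsq; exact: measurable_funB.
have mh n : measurable_fun setT (h n) by apply: measurable_funeM.
have h0 n x : setT x -> (0 <= h n x)%E.
  by move=> _; rewrite /h -EFinM lee_fin; apply: mulr_ge0;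
    rewrite ?exprn_ge0// mulr_ge0 ?sqr_ge0.
have sum_oo : (\int[m]_x (\sum_(n <oo) h n x) < +oo)%E.
  rewrite integral_nneseries//.
  apply: (@le_lt_trans _ _ (\sum_(n <oo) (C * 4^-1 ^+ n)%:E)%E).
    apply: lee_nneseries => [n _ _|n _].
      by apply: integral_ge0 => x _; exact: h0.
    rewrite ge0_integralZl_EFin//; last first.
      by move=> x _; rewrite lee_fin mulr_ge0 ?sqr_ge0.
    apply: le_trans (lee_wpmul2l _ (aC n)) _; first by rewrite lee_fin exprn_ge0.
    rewrite -EFinM lee_fin mulrCA -exprMn.
    by rewrite (_ : 4 * 16^-1 = 4^-1)//; field.
  have cg : cvgn (series (geometric C 4^-1)).
    by apply: is_cvg_geometric_series; rewrite ger0_norm ?invf_lt1// ltr1n.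
  rewrite (_ : (\sum_(n <oo) _)%E = (limn (series (geometric C 4^-1)))%:E) ?ltry//.
  rewrite -EFin_lim//; congr (limn _); apply/funext => n /=.
  by rewrite /series/= sumEFin.
have : m.-integrable setT (fun x => \sum_(n <oo) h n x)%E.
  apply/integrableP; split; first by apply: ge0_emeasurable_sum => // n x _ _; exact: h0.
  apply: le_lt_trans sum_oo; rewrite le_eqVlt; apply/orP; left; apply/eqP.
  by apply: eq_integral => x _; rewrite gee0_abs// nneseries_ge0// => n _ _; exact: h0.
move/(integrable_ae measurableT); apply: filterS => x /(_ I) fx.
have [kx|kx] := eqVneq (k x) 0; [by left|right].
have kp : 0 < k x by rewrite lt_def kx k0.
apply: (@cvg_of_fast_increments _ _ (fine (\sum_(n <oo) h n x)%E / k x)) => n.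
rewrite ler_pdivlMr// -mulrA -lee_fin fineK// EFinM -/(h n x).
rewrite (@nneseriesD1 _ _ n)//; last by move=> i _; exact: h0.
by rewrite leeDl//; apply: nneseries_ge0 => i _ _; exact: h0.
Qed.

End weighted_form.

(** * Null sets and iterated integrals on products *)

Section ae_product.
Context d1 d2 (T1 : measurableType d1) (T2 : measurableType d2) (R : realType).
Variables (m1 : {sigma_finite_measure set T1 -> \bar R}).
Variables (m2 : {sigma_finite_measure set T2 -> \bar R}).
Local Notation pi := (m1 \x m2)%E.

Let ae0_integral0 d (T : measurableType d) (m : {measure set T -> \bar R})
    (h : T -> \bar R) : measurable_fun setT h -> (forall x, (0 <= h x)%E) ->
  (\int[m]_x h x = 0)%E -> {ae m, forall x, h x = 0%E}.
Proof.
move=> mh h0 hi; have : (\int[m]_x `|h x| = 0)%E.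
  by rewrite -[RHS]hi; apply: eq_integral => x _; rewrite gee0_abs.
by move/(ae_eq_integral_abs m measurableT mh); apply: filterS => x; exact.
Qed.

Let indic_eq0 (T : Type) (N : set T) (x : T) :
  (\1_N x)%:E = 0 :> \bar R -> ~ N x.
Proof.
rewrite indicE => -[] /eqP; case: (boolP (x \in N)) => [_|/negP + _ Nx].
  by rewrite oner_eq0.
by apply; exact: mem_set.
Qed.

(** The indicator of a null set containing the exceptional pairs has integral 0; by Tonelli almost
    every section of it is null. *)
Lemma ae_prod12 (P : T1 * T2 -> Prop) : {ae pi, forall z, P z} ->
  {ae m1, forall x, {ae m2, forall y, P (x, y)}}.
Proof.
move=> [N [mN N0 PN]].
have mI : measurable_fun setT (fun z => (\1_N z)%:E : \bar R).
  by apply/measurable_EFinP.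
have I0 z : (0 <= (\1_N z)%:E :> \bar R)%E by rewrite lee_fin.
have : (\int[pi]_z (\1_N z)%:E = 0)%E by rewrite integral_indic// setIT.
rewrite fubini_tonelli1// => /ae0_integral0.
have mF := measurable_fun_fubini_tonelli_F (m2 := m2) _ mI I0.
have F0 x : (0 <= fubini_F m2 (fun z => (\1_N z)%:E) x)%E.
  by apply: integral_ge0 => y _; exact: I0.
move=> /(_ mF F0); apply: filterS => x /ae0_integral0.
have mx : measurable_fun setT (fun y => (\1_N (x, y))%:E : \bar R).
  exact: measurableT_comp mI _.
move=> /(_ mx (fun y => I0 (x, y))); apply: filterS => y h; have nN := indic_eq0 h.
by apply: contrapT => nP; exact: (nN (PN (x, y) nP)).
Qed.

Lemma ae_prod21 (P : T1 * T2 -> Prop) : {ae pi, forall z, P z} ->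
  {ae m2, forall y, {ae m1, forall x, P (x, y)}}.
Proof.
move=> [N [mN N0 PN]].
have mI : measurable_fun setT (fun z => (\1_N z)%:E : \bar R).
  by apply/measurable_EFinP.
have I0 z : (0 <= (\1_N z)%:E :> \bar R)%E by rewrite lee_fin.
have : (\int[pi]_z (\1_N z)%:E = 0)%E by rewrite integral_indic// setIT.
rewrite fubini_tonelli2// => /ae0_integral0.
have mG := measurable_fun_fubini_tonelli_G (m1 := m1) _ mI I0.
have G0 y : (0 <= fubini_G m1 (fun z => (\1_N z)%:E) y)%E.
  by apply: integral_ge0 => x _; exact: I0.
move=> /(_ mG G0); apply: filterS => y /ae0_integral0.
have my : measurable_fun setT (fun x => (\1_N (x, y))%:E : \bar R).
  exact: measurableT_comp mI _.
move=> /(_ my (fun x => I0 (x, y))); apply: filterS => x h; have nN := indic_eq0 h.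
by apply: contrapT => nP; exact: (nN (PN (x, y) nP)).
Qed.

Lemma ae_prod_fst (P : T1 -> Prop) : {ae m1, forall x, P x} ->
  {ae pi, forall z, P z.1}.
Proof.
move=> [N [mN N0 PN]]; exists (N `*` setT); split.
- exact: measurableX.
- rewrite /= product_measure1E//; apply/eqP; rewrite mule_eq0; apply/orP; left.
  exact/eqP.
- by move=> z /PN Nz; split.
Qed.

End ae_product.

Section iterated.
Context d1 d2 (T1 : measurableType d1) (T2 : measurableType d2) (R : realType).
Variables (m1 : {sigma_finite_measure set T1 -> \bar R}).
Variables (m2 : {sigma_finite_measure set T2 -> \bar R}).

Lemma integral2_mkcond (A : set T1) (B : set T2) (h : T1 -> T2 -> R) :
  (\int[m1]_(x in A) \int[m2]_(y in B) (h x y)%:E =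
   \int[m1]_x \int[m2]_y (\1_A x * \1_B y * h x y)%:E)%E.
Proof.
rewrite integral_mkcond; apply: eq_integral => x _; rewrite patchE.
case: (boolP (x \in A)) => xA; rewrite !indicE ?xA ?(negbTE xA); last first.
  rewrite (eq_integral (cst 0%E)) ?integral0// => y _.
  by rewrite !mul0r.
rewrite integral_mkcond; apply: eq_integral => y _; rewrite patchE indicE mul1r.
by case: (y \in B); rewrite ?mul1r ?mul0r.
Qed.

Lemma integral2_wform (k : T1 * T2 -> R) a b : measurable_fun setT k ->
  (forall z, 0 <= k z) -> wL2 (m1 \x m2)%E k a -> wL2 (m1 \x m2)%E k b ->
  (\int[m1]_x \int[m2]_y (a (x, y) * b (x, y) * k (x, y))%:E =
   (wform (m1 \x m2)%E k a b)%:E)%E.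
Proof.
move=> mk k0 Wa Wb; have I := wL2_integrable mk k0 Wa Wb.
rewrite (integral12_prod_meas1 I) /wform /Rintegral fineK//.
exact: integrable_fin_num.
Qed.

End iterated.

(** * Comparison of weights and Cauchy-Schwarz *)

Section weighted_form_more.
Context {d : measure_display} {T : measurableType d} {R : realType}.
Variable m : {measure set T -> \bar R}.

Lemma wsq_le (k1 k2 : T -> R) (C : R) a : measurable_fun setT k1 ->
  measurable_fun setT k2 -> (forall x, 0 <= k1 x) -> 0 <= C ->
  (forall x, k1 x <= C * k2 x) -> measurable_fun setT a ->
  (wsq m k1 a <= C%:E * wsq m k2 a)%E.
Proof.
move=> mk1 mk2 k10 C0 k12 ma.
have k20 x : C * (a x ^+ 2 * k2 x) = a x ^+ 2 * (C * k2 x) by ring.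
have mC : measurable_fun setT (fun x => C * k2 x) by exact: measurable_funM.
have k30 x : 0 <= C * k2 x by exact: le_trans (k12 x).
have -> : (C%:E * wsq m k2 a = \int[m]_x (a x ^+ 2 * (C * k2 x))%:E)%E.
  (* Nonnegativity of [k2] is read off from [0 <= C * k2 x], which requires [0 < C]. For [C = 0] the
     product is 0 even if the integral is infinite. *)
  have [C00|C00] := eqVneq C 0.
    rewrite C00 mul0e; under eq_integral do rewrite mul0r mulr0.
    by rewrite integral0.
  rewrite -ge0_integralZl_EFin//; last 2 first.
  - by move=> x _; rewrite lee_fin mulr_ge0 ?sqr_ge0// -(pmulr_rge0 _ (_ : 0 < C)) ?lt_def ?C00.
  - exact: measurable_wsq.
  by apply: eq_integral => x _; rewrite -EFinM k20.
apply: ge0_le_integral => //.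
- by move=> x _; rewrite lee_fin mulr_ge0 ?sqr_ge0.
- exact: measurable_wsq.
- exact: (@measurable_wsq _ _ _ (fun x => C * k2 x)).
- by move=> x _; rewrite lee_fin ler_wpM2l ?sqr_ge0.
Qed.

Lemma wL2_le (k1 k2 : T -> R) (C : R) a : measurable_fun setT k1 ->
  measurable_fun setT k2 -> (forall x, 0 <= k1 x) -> 0 <= C ->
  (forall x, k1 x <= C * k2 x) -> wL2 m k2 a -> wL2 m k1 a.
Proof.
move=> mk1 mk2 k10 C0 k12 [ma aoo]; split => //.
apply: le_lt_trans (wsq_le mk1 mk2 k10 C0 k12 ma) _.
by apply: lte_mul_pinfty; rewrite ?lee_fin.
Qed.

End weighted_form_more.
Section weighted_form_vector_space.
Context {d : measure_display} {T : measurableType d} {R : realType}.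
Variables (m : {measure set T -> \bar R}) (k : T -> R).
Hypotheses (mk : measurable_fun setT k) (k0 : forall x, 0 <= k x).

Let V : set (T -> R) := wL2 m k.

Let V0 : V (0 : T -> R).
Proof. exact: wL20. Qed.

Let VZD t (u v : T -> R) : V u -> V v -> V (t *: u + v).
Proof. exact: wL2_ZD. Qed.

Let BC (u v : T -> R) : V u -> V v -> wform m k u v = wform m k v u.
Proof. by move=> _ _; exact: wformC. Qed.

Let BZD t (u v w : T -> R) : V u -> V v -> V w ->
  wform m k (t *: u + v) w = t * wform m k u w + wform m k v w.
Proof. exact: wformZD. Qed.

Lemma wform_combination a b (u v : T -> R) : wL2 m k u -> wL2 m k v ->
  wL2 m k (fun x => a * u x + b * v x) /\
  wform m k (fun x => a * u x + b * v x) (fun x => a * u x + b * v x) =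
  a ^+ 2 * wform m k u u + 2 * a * b * wform m k u v + b ^+ 2 * wform m k v v.
Proof. by move=> Wu Wv; exact: (form_ZD V0 VZD BC BZD a b Wu Wv). Qed.

Lemma wform_cauchy_schwarz u v : wL2 m k u -> wL2 m k v ->
  wform m k u v ^+ 2 <= wform m k u u * wform m k v v.
Proof.
move=> Wu Wv; apply: (form_cauchy_schwarz V0 VZD BC BZD _ Wu Wv) => w.
exact: wform_ge0.
Qed.

End weighted_form_vector_space.

(** * The weights of the nonlocal form and the space V *)

Section nonlocal_form.
Variables (R : realType) (d : nat) (Omega : set (Rd R d)).
Variable gamma : Rd R d -> Rd R d -> R.
Variable Z : set (Rd R d * Rd R d).
Local Notation mu := (@lebesgue R d).
Local Notation pi := (mu \x mu)%E.
Hypothesis mOmega : measurable Omega.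
Hypothesis gamma_ge0 : forall x y, 0 <= gamma x y.
Hypothesis gamma_sym : forall x y, gamma x y = gamma y x.
Hypothesis mZ : measurable Z.
Hypothesis Z0 : pi Z = 0%E.
Hypothesis mgZ : measurable_fun setT (fun z => gamma z.1 z.2 * \1_(~` Z) z).

Implicit Types (u v w : Rd R d -> R) (z : Rd R d * Rd R d).

(* The product-measurable version of [gamma]. *)
Definition gker z : R := gamma z.1 z.2 * \1_(~` Z) z.

Definition increment v z : R := v z.1 - v z.2.

Definition kfull z : R := \1_Omega z.1 * gker z.

Definition kin z : R := \1_Omega z.1 * \1_Omega z.2 * gker z.

(** The complement of [Omega] stands in for [Gamma]; by [ae_kout] this changes the weight only on a
    null set. *)
Definition kout z : R := \1_Omega z.1 * \1_(~` Omega) z.2 * gker z.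

Definition kform z : R := 2^-1 * kin z + kout z.

Definition energy u v : R := wform pi kform (increment u) (increment v).

Lemma gker_ge0 z : 0 <= gker z.
Proof. by rewrite /gker mulr_ge0. Qed.

Let mfst (A : set (Rd R d)) : measurable A ->
  measurable_fun setT (fun z => \1_A z.1 : R).
Proof. by move=> mA; apply: measurableT_comp; [exact: measurable_indic|]. Qed.

Let msnd (A : set (Rd R d)) : measurable A ->
  measurable_fun setT (fun z => \1_A z.2 : R).
Proof. by move=> mA; apply: measurableT_comp; [exact: measurable_indic|]. Qed.

Lemma measurable_kfull : measurable_fun setT kfull.
Proof. by apply: measurable_funM => //; exact: mfst. Qed.

Lemma measurable_kin : measurable_fun setT kin.
Proof.
apply: measurable_funM => //; apply: measurable_funM; [exact: mfst|exact: msnd].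
Qed.

Lemma measurable_kout : measurable_fun setT kout.
Proof.
apply: measurable_funM => //; apply: measurable_funM; first exact: mfst.
by apply: msnd; exact: measurableC.
Qed.

Lemma measurable_kform : measurable_fun setT kform.
Proof.
apply: measurable_funD; last exact: measurable_kout.
by apply: measurable_funM => //; exact: measurable_kin.
Qed.

Lemma kfull_ge0 z : 0 <= kfull z.
Proof. by rewrite mulr_ge0 ?gker_ge0. Qed.

Lemma kin_ge0 z : 0 <= kin z.
Proof. by rewrite !mulr_ge0 ?gker_ge0. Qed.

Lemma kout_ge0 z : 0 <= kout z.
Proof. by rewrite !mulr_ge0 ?gker_ge0. Qed.

Lemma kform_ge0 z : 0 <= kform z.
Proof. by rewrite addr_ge0 ?mulr_ge0 ?kin_ge0 ?kout_ge0 ?invr_ge0. Qed.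

Lemma kfullE z : kfull z = kin z + kout z.
Proof.
rewrite /kfull /kin /kout -mulrDl -mulrDr !indicE in_setC.
by case: (z.2 \in Omega); rewrite /= ?addr0 ?add0r mulr1.
Qed.

Lemma kin_le z : kin z <= 1 * kfull z.
Proof. by rewrite kfullE mul1r lerDl kout_ge0. Qed.

Lemma kout_le z : kout z <= 1 * kfull z.
Proof. by rewrite kfullE mul1r lerDr kin_ge0. Qed.

Lemma kform_le z : kform z <= 1 * kfull z.
Proof. by rewrite kfullE /kform; have := kin_ge0 z; lra. Qed.

Lemma kfull_le z : kfull z <= 2 * kform z.
Proof. by rewrite kfullE /kform; have := kout_ge0 z; lra. Qed.

Lemma measurable_increment v : measurable_fun setT v ->
  measurable_fun setT (increment v).
Proof.
move=> mv; apply: measurable_funB.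
  by apply: measurableT_comp => //; exact: measurable_fst.
by apply: measurableT_comp => //; exact: measurable_snd.
Qed.

(** The problem is stated with [gamma y x] while [gker (x, y)] reads [gamma x y]: symmetry exchanges
    the two, and almost every section of [Z] is null. *)
Lemma ae_gamma : {ae mu, forall x, {ae mu, forall y, gamma y x = gker (x, y)}}.
Proof.
apply: (@ae_prod12 _ _ _ _ _ _ _ (fun z => gamma z.2 z.1 = gker z)).
exists Z; split => // z nz; apply: contrapT => nZ; apply: nz.
by rewrite /= gamma_sym /gker indicE mem_set// mulr1.
Qed.

Lemma ae_gamma21 : {ae mu, forall y, {ae mu, forall x, gamma y x = gker (x, y)}}.
Proof.
apply: (@ae_prod21 _ _ _ _ _ _ _ (fun z => gamma z.2 z.1 = gker z)).
exists Z; split => // z nz; apply: contrapT => nZ; apply: nz.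
by rewrite /= gamma_sym /gker indicE mem_set// mulr1.
Qed.

Lemma integral2_gamma (B : set (Rd R d)) (h : Rd R d -> Rd R d -> R) :
  (\int[mu]_(x in Omega) \int[mu]_(y in B) (h x y * gamma y x)%:E =
   \int[mu]_x \int[mu]_y (h x y * (\1_Omega x * \1_B y * gker (x, y)))%:E)%E.
Proof.
rewrite integral2_mkcond; apply: ae_eq_integral_any.
apply: filterS ae_gamma => x gx _; apply: ae_eq_integral_any.
by apply: filterS gx => y -> _; congr EFin; ring.
Qed.

(** A version of the integral defining [Gamma] that is measurable in [y], equal to it for almost
    every [y]. *)
Definition inflow (y : Rd R d) : \bar R := (\int[mu]_x (kfull (x, y))%:E)%E.

Lemma ae_Gamma : {ae mu, forall y,
  Gamma Omega gamma y <-> ~ Omega y /\ (0 < inflow y)%E}.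
Proof.
apply: filterS ae_gamma21 => y gy.
suff -> : inflow y = (\int[mu]_(x in Omega) (gamma y x)%:E)%E by [].
rewrite integral_mkcond; apply: ae_eq_integral_any.
apply: filterS gy => x gxy _; rewrite patchE /kfull indicE.
by case: (x \in Omega); rewrite /= ?mul0r ?mul1r// -gxy.
Qed.

Lemma measurable_inflow : measurable_fun setT inflow.
Proof.
apply: (@measurable_fun_fubini_tonelli_G _ _ _ _ _ mu (EFin \o kfull)).
- by apply/measurable_EFinP; exact: measurable_kfull.
- by move=> z; rewrite lee_fin kfull_ge0.
Qed.

(** Integrating [kfull] over the pairs whose second point has zero inflow, first variable first,
    gives 0 by Tonelli. *)
Lemma ae_inflow0 : {ae pi, forall z, inflow z.2 = 0%E -> kfull z = 0}.
Proof.
pose A := [set y | inflow y = 0%E].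
have mA : measurable A.
  by have := measurable_inflow measurableT (emeasurable_set1 0%E); rewrite setTI.
pose h z := (\1_A z.2 * kfull z)%:E : \bar R.
have mh : measurable_fun setT h.
  apply/measurable_EFinP; apply: measurable_funM; last exact: measurable_kfull.
  exact: msnd.
have h0 z : (0 <= h z)%E by rewrite lee_fin mulr_ge0 ?kfull_ge0.
have : (\int[pi]_z `|h z| = 0)%E.
  under eq_integral do rewrite gee0_abs//.
  rewrite fubini_tonelli2// /fubini_G; apply: integral0_eq => y _.
  case: (boolP (y \in A)) => yA; rewrite /h/= indicE.
    rewrite yA; under eq_integral do rewrite mul1r.
    exact: set_mem yA.
  by rewrite (negbTE yA); under eq_integral do rewrite mul0r; rewrite integral0.
move=> /(ae_eq_integral_abs _ measurableT mh); apply: filterS => z /(_ I).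
by rewrite /h indicE => -[] /[swap] zA; rewrite mem_set// mul1r.
Qed.

(** Almost every point outside both [Omega] and [Gamma] has zero inflow, and for almost all pairs
    ending at such a point the kernel vanishes. *)
Lemma ae_kout : {ae mu, forall x, {ae mu, forall y,
  \1_Omega x * \1_(Gamma Omega gamma) y * gker (x, y) = kout (x, y)}}.
Proof.
have := ae_prod12 ae_inflow0; apply: filterS => x kx.
apply: filterS2 kx ae_Gamma => y /= ky yG; rewrite /kout /=.
have [Oy|nOy] := pselect (Omega y).
  rewrite !indicE (memNset (_ : ~ Gamma Omega gamma y)); last by move/yG => [].
  by rewrite [y \in ~` Omega]memNset ?mulr0 ?mul0r// => /(_ Oy).
have [y0|y0] := eqVneq (inflow y) 0%E.
  have /eqP := ky y0; rewrite /kfull/= => /eqP k0.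
  by rewrite mulrAC k0 mul0r mulrAC k0 mul0r.
have Gy : Gamma Omega gamma y.
  apply/yG; split => //; rewrite lt_def y0; apply: integral_ge0 => x' _.
  by rewrite lee_fin kfull_ge0.
by rewrite !indicE [y \in Gamma _ _]mem_set// [y \in ~` Omega]mem_set.
Qed.

Lemma integral_setE (h : Rd R d -> R) :
  (\int[mu]_(x in Omega) (h x)%:E = \int[mu]_x (h x * \1_Omega x)%:E)%E.
Proof.
rewrite integral_mkcond; apply: eq_integral => x _; rewrite patchE indicE.
by case: ifP; rewrite ?mulr1 ?mulr0.
Qed.

Lemma indic_Omega_ge0 (x : Rd R d) : 0 <= \1_Omega x :> R.
Proof. by []. Qed.

Lemma measurable_indic_Omega : measurable_fun setT (\1_Omega : Rd R d -> R).
Proof. exact: measurable_indic. Qed.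

Lemma dirichletE v : measurable_fun setT v ->
  (\int[mu]_(x in Omega) \int[mu]_y ((v x - v y) ^+ 2 * gamma y x)%:E =
   wsq pi kfull (increment v))%E.
Proof.
move=> mv; rewrite (integral2_gamma setT (fun x y => (v x - v y) ^+ 2)).
rewrite /wsq fubini_tonelli1.
- by apply: eq_integral => x _; apply: eq_integral => y _; rewrite indicT mulr1.
- by apply: (measurable_wsq measurable_kfull); exact: measurable_increment.
- by move=> z; rewrite lee_fin mulr_ge0 ?sqr_ge0 ?kfull_ge0.
Qed.

(** [kform] and [kfull] agree up to a factor 2, so the weight of the energy can replace that of the
    norm. *)
Lemma VP v : V Omega gamma v <->
  wL2 mu \1_Omega v /\ wL2 pi kform (increment v).
Proof.
have mk := measurable_kfull; have ms := measurable_kform.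
have Oge0 := wsq_ge0 mu indic_Omega_ge0 v.
have Fge0 := wsq_ge0 pi kfull_ge0 (increment v).
split=> [[mv]|[[mv voo] Dv]].
  rewrite /normV2 dirichletE// integral_setE => nv; split.
    by split => //; apply: le_lt_trans nv; rewrite leeDl.
  apply: (wL2_le ms mk kform_ge0 ler01 kform_le).
  split; first exact: measurable_increment.
  by apply: le_lt_trans nv; rewrite leeDr.
split=> //; rewrite /normV2 dirichletE// integral_setE lte_add_pinfty//.
by have [] := wL2_le mk ms kfull_ge0 (ler0n _ _) kfull_le Dv.
Qed.

Lemma increment_ZD t u v :
  increment (fun x => t * u x + v x) = fun z => t * increment u z + increment v z.
Proof. by apply/funext => z; rewrite /increment; ring. Qed.

Lemma V_ZD t u v : V Omega gamma u -> V Omega gamma v ->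
  V Omega gamma (fun x => t * u x + v x).
Proof.
move=> /VP[Wu Du] /VP[Wv Dv]; apply/VP; split.
  exact: wL2_ZD measurable_indic_Omega indic_Omega_ge0 _ _ _ Wu Wv.
rewrite increment_ZD.
exact: wL2_ZD measurable_kform kform_ge0 _ _ _ Du Dv.
Qed.

(** The increments are square integrable for every weight involved, so both double integrals
    converge absolutely and may be combined as real numbers. *)
Lemma bilinE u v : V Omega gamma u -> V Omega gamma v ->
  bilin Omega gamma u v = (energy u v)%:E.
Proof.
move=> /VP[_ Du] /VP[_ Dv].
have mf := measurable_kfull; have ms := measurable_kform.
have mi := measurable_kin; have mo := measurable_kout.
have Fu := wL2_le mf ms kfull_ge0 (ler0n _ _) kfull_le Du.
have Fv := wL2_le mf ms kfull_ge0 (ler0n _ _) kfull_le Dv.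
have Iu := wL2_le mi mf kin_ge0 ler01 kin_le Fu.
have Iv := wL2_le mi mf kin_ge0 ler01 kin_le Fv.
have Ou := wL2_le mo mf kout_ge0 ler01 kout_le Fu.
have Ov := wL2_le mo mf kout_ge0 ler01 kout_le Fv.
rewrite /bilin !(integral2_gamma _ (fun x y => (u x - u y) * (v x - v y))).
rewrite (integral2_wform mi kin_ge0 Iu Iv).
rewrite [X in (_ + X)%E](_ : _ = (wform pi kout (increment u) (increment v))%:E).
  rewrite -EFinM -EFinD; congr EFin; rewrite /energy /wform.
  have I1 := wL2_integrable mi kin_ge0 Iu Iv.
  have I2 := wL2_integrable mo kout_ge0 Ou Ov.
  rewrite -(RintegralZl _ measurableT I1) -(RintegralD measurableT (integrableZl measurableT 2^-1 I1) I2).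
  by apply: eq_Rintegral => z _; rewrite /kform; ring.
rewrite -(integral2_wform mo kout_ge0 Ou Ov); apply: ae_eq_integral_any.
apply: filterS ae_kout => x kx _; apply: ae_eq_integral_any.
by apply: filterS kx => y -> _.
Qed.

(** * Integrals over the domain and the Poincare inequality *)

Hypothesis Omega_fin : (mu Omega < +oo)%E.

(** The measure of [Omega] and the integral of [u] over it, written as weighted forms so that
    bilinearity and Cauchy-Schwarz apply to them. *)
Definition vol : R := wform mu \1_Omega (cst 1) (cst 1).

Definition mass u : R := wform mu \1_Omega u (cst 1).

Lemma wL2_one : wL2 mu \1_Omega (cst 1).
Proof.
split; first exact: measurable_cst.
rewrite /wsq; under eq_integral do rewrite /= expr1n mul1r.
by rewrite integral_indic// setIT.
Qed.

Lemma volE : mu Omega = vol%:E.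
Proof.
rewrite /vol -wsqE ?measurable_indic_Omega//; last exact: wL2_one.
rewrite /wsq; under eq_integral do rewrite /= expr1n mul1r.
by rewrite integral_indic// setIT.
Qed.

Lemma V_one : V Omega gamma (cst 1).
Proof.
apply/VP; split; first exact: wL2_one.
rewrite (_ : increment _ = fun=> 0); last by apply/funext => z; rewrite /increment subrr.
exact: wL20.
Qed.

Lemma wL2_affine a b v : wL2 mu \1_Omega v ->
  wL2 mu \1_Omega (fun x => a * v x + b * 1).
Proof.
move=> Wv; exact: (wform_combination measurable_indic_Omega indic_Omega_ge0
  a b Wv wL2_one).1.
Qed.

Lemma wform_affine a b v : wL2 mu \1_Omega v ->
  wform mu \1_Omega (fun x => a * v x + b * 1) (fun x => a * v x + b * 1) =
  a ^+ 2 * wform mu \1_Omega v v + 2 * a * b * mass v + b ^+ 2 * vol.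
Proof.
move=> Wv; exact: (wform_combination measurable_indic_Omega indic_Omega_ge0
  a b Wv wL2_one).2.
Qed.

Lemma double_integral_square v : wL2 mu \1_Omega v ->
  (\int[mu]_(x in Omega) \int[mu]_(y in Omega) ((v x - v y) ^+ 2)%:E =
   (2 * (vol * wform mu \1_Omega v v - mass v ^+ 2))%:E)%E.
Proof.
move=> Wv; have mO := measurable_indic_Omega; have O0 := indic_Omega_ge0.
set N := wform _ _ v v.
(* The inner integral is quadratic in [v x]. Grouped as an affine function times [v x] plus a
   constant, it integrates to a sum of weighted forms. *)
have inner x : (\int[mu]_(y in Omega) ((v x - v y) ^+ 2)%:E =
    ((vol * v x + (- 2 * mass v) * 1) * v x + N)%:E)%E.
  rewrite integral_setE.
  transitivity (wsq mu \1_Omega (fun y => - 1 * v y + v x * 1)).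
    by apply: eq_integral => y _; congr (_ * _)%:E; ring.
  rewrite (wsqE mO O0 (wL2_affine _ _ Wv)).
  by rewrite wform_affine//; congr EFin; rewrite /N; ring.
under eq_integral do rewrite inner.
rewrite integral_setE.
have W1 := wL2_affine vol (- 2 * mass v) Wv.
have i1 := wL2_integrable mO O0 W1 Wv.
have i2 := integrableZl measurableT N (wL2_integrable mO O0 wL2_one wL2_one).
transitivity (\int[mu]_x ((vol * v x + - 2 * mass v * 1) * v x * \1_Omega x)%:E +
    \int[mu]_x (N%:E * (1 * 1 * \1_Omega x)%:E))%E.
  rewrite -integralD//; apply: eq_integral => x _.
  by rewrite -EFinM -EFinD; congr EFin; ring.
rewrite (integralZl measurableT (wL2_integrable mO O0 wL2_one wL2_one)).
have fE a b : wL2 mu \1_Omega a -> wL2 mu \1_Omega b ->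
    (\int[mu]_x (a x * b x * \1_Omega x)%:E = (wform mu \1_Omega a b)%:E)%E.
  move=> Wa Wb; rewrite /wform /Rintegral fineK//.
  exact: integrable_fin_num (wL2_integrable mO O0 Wa Wb).
rewrite (fE (fun x => vol * v x + - 2 * mass v * 1) v)//.
rewrite (fE (cst 1) (cst 1)); try exact: wL2_one.
have Wb : wL2 mu \1_Omega (fun x => - 2 * mass v * 1).
  have := wL2_affine 0 (- 2 * mass v) Wv.
  by rewrite (_ : (fun x => _ + _) = (fun x => - 2 * mass v * 1)) //;
    apply/funext => x; ring.
rewrite -EFinM -EFinD; congr EFin.
rewrite wformZD// -/N.
have H c : wform mu \1_Omega (fun=> c * 1) v = c * mass v.
  have := wformZD mO O0 c wL2_one (wL20 mu \1_Omega) Wv.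
  have -> : wform mu \1_Omega (fun=> 0) v = 0.
    rewrite /wform; under eq_Rintegral do rewrite !mul0r.
    by rewrite Rintegral_cst// mul0r.
  rewrite addr0 [wform _ _ (cst 1) v]wformC => <-; congr wform.
  by apply/funext => x; rewrite addr0.
rewrite H -/(mass v).
by rewrite /vol; ring.
Qed.

Variable C : R.
Hypothesis C_gt0 : 0 < C.
Hypothesis poincare : forall v, V Omega gamma v ->
  (\int[mu]_(x in Omega) \int[mu]_(y in Omega) ((v x - v y) ^+ 2)%:E <=
   C%:E * \int[mu]_(x in Omega) \int[mu]_y ((v x - v y) ^+ 2 * gamma y x)%:E)%E.
Hypothesis vol_gt0 : 0 < vol.

Lemma energy_ge0 v : V Omega gamma v -> 0 <= energy v v.
Proof. by move=> /VP[_ Dv]; exact: (wform_ge0 measurable_kform kform_ge0). Qed.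

(** The 2 in the double integral of the square cancels against the 2 in [kfull_le]. *)
Lemma poincare_energy v : V Omega gamma v ->
  vol * wform mu \1_Omega v v - mass v ^+ 2 <= C * energy v v.
Proof.
move=> Vv; have [Wv Dv] := (VP v).1 Vv.
have := poincare Vv; rewrite double_integral_square// dirichletE; last by case: Wv.
move=> le; suff : ((2 * (vol * wform mu \1_Omega v v - mass v ^+ 2))%:E <=
    (C * (2 * energy v v))%:E)%E by rewrite lee_fin mulrCA ler_pM2l.
apply: le_trans le _; rewrite EFinM lee_pmul2l// EFinM.
rewrite /energy -wsqE//; last exact: kform_ge0.
  exact: wsq_le measurable_kfull measurable_kform kfull_ge0 (ler0n _ _) kfull_le Dv.1.
exact: measurable_kform.
Qed.

(** The Poincare bound controls [v] up to its mean, and the squared mass supplies the mean; [C + 1]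
    dominates the coefficients [C] and 1 of the two terms. *)
Lemma energy_coercive v : V Omega gamma v ->
  wform mu \1_Omega v v <= (C + 1) / vol * (energy v v + mass v * mass v).
Proof.
move=> Vv; rewrite mulrAC ler_pdivlMr// mulrC.
have := poincare_energy Vv; have := energy_ge0 Vv; have := sqr_ge0 (mass v).
rewrite expr2; move: (mass v * mass v) (energy v v) => i e i0 e0.
by have := mulr_ge0 (ltW C_gt0) i0; lra.
Qed.

Lemma energy0_constant w : V Omega gamma w -> energy w w = 0 ->
  exists c : R, {ae mu, forall x, (Omega `|` Gamma Omega gamma) x -> w x = c}.
Proof.
move=> Vw Sw; have [Ww Dw] := (VP w).1 Vw.
have mO := measurable_indic_Omega; have O0 := indic_Omega_ge0.
(* [c] is the mean of [w]: multiplied by [vol], the integral of the squared deviation from it is the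
   left side of [poincare_energy]. *)
pose c := mass w / vol; exists c.
have wc : {ae mu, forall x, Omega x -> w x = c}.
  have W1 := wL2_affine 1 (- c) Ww.
  have : wform mu \1_Omega (fun x => 1 * w x + - c * 1) (fun x => 1 * w x + - c * 1) = 0.
    apply/eqP; rewrite eq_le (wform_ge0 mO O0 W1) andbT wform_affine//.
    have := poincare_energy Vw; rewrite Sw mulr0 subr_le0 => le.
    rewrite -(pmulr_rle0 _ vol_gt0).
    have -> : vol * (1 ^+ 2 * wform mu \1_Omega w w + 2 * 1 * - c * mass w +
        (- c) ^+ 2 * vol) = vol * wform mu \1_Omega w w - mass w ^+ 2.
      by rewrite /c; field; rewrite gt_eqF.
    by rewrite subr_le0.
  move/(wform_eq0_ae mO O0 W1); apply: filterS => x + Ox.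
  rewrite indicE mem_set// !mulr1 => /eqP; rewrite sqrf_eq0 => /eqP; lra.
have := ae_prod21 (wform_eq0_ae measurable_kform kform_ge0 Dw Sw).
move=> /= Dw0; have wc' := wc; apply: filterS3 wc' Dw0 ae_Gamma => y wcy Dy yG [/wcy//|].
move=> /yG[nOy infl]; apply/eqP/negPn/negP => wyc.
(* If [w y] differed from [c], zero energy would force the kernel between [y] and almost every point
   of [Omega] to vanish. *)
suff : inflow y = 0%E by move=> y0; move: infl; rewrite y0 ltxx.
rewrite /inflow (ae_eq_integral_any (g := cst 0%E)) ?integral0//.
apply: filterS2 wc Dy => x wx Dxy _.
have [Ox|nOx] := pselect (Omega x); last first.
  by rewrite /kfull /= indicE memNset// mul0r.
move: Dxy; rewrite /increment /kform kfullE /kin /= !indicE (memNset nOy) mulr0 mul0r.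
rewrite mulr0 !add0r (wx Ox) => /eqP; rewrite mulf_eq0 sqrf_eq0 subr_eq0.
by rewrite eq_sym (negbTE wyc)/= => /eqP ->.
Qed.

(** * Completeness of V for the energy plus the squared mass *)

Let E := Rd R d -> R.
Let form u v := energy u v + mass u * mass v.

Lemma energyZD t u v w : V Omega gamma u -> V Omega gamma v ->
  V Omega gamma w -> energy (fun x => t * u x + v x) w = t * energy u w + energy v w.
Proof.
move=> /VP[_ Du] /VP[_ Dv] /VP[_ Dw]; rewrite /energy increment_ZD.
exact: (wformZD measurable_kform kform_ge0 t Du Dv Dw).
Qed.

Lemma massZD t u v : V Omega gamma u -> V Omega gamma v ->
  mass (fun x => t * u x + v x) = t * mass u + mass v.
Proof.
move=> /VP[Wu _] /VP[Wv _].
exact: (wformZD measurable_indic_Omega indic_Omega_ge0 t Wu Wv wL2_one).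
Qed.

Lemma V_sub u v : V Omega gamma u -> V Omega gamma v ->
  V Omega gamma (fun x => u x - v x).
Proof.
move=> Vu Vv; have := V_ZD (- 1) Vv Vu.
by rewrite (_ : (fun x => _ + _) = (fun x => u x - v x))//; apply/funext => x; ring.
Qed.

Lemma increment_sub u v :
  increment (fun x => u x - v x) = fun z => increment u z - increment v z.
Proof. by apply/funext => z; rewrite /increment; ring. Qed.

Lemma V_complete (v : nat -> Rd R d -> R) : (forall n, V Omega gamma (v n)) ->
  (forall n m, (n <= m)%N ->
    form (fun x => v n x - v m x) (fun x => v n x - v m x) <= 16^-1 ^+ n) ->
  exists2 u, V Omega gamma u &
    form (fun x => v n x - u x) (fun x => v n x - u x) @[n --> \oo] --> 0.
Proof.
move=> Vv vcauchy; have mO := measurable_indic_Omega.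
have O0 := indic_Omega_ge0; have ms := measurable_kform.
pose K := (C + 1) / vol.
have K0 : 0 <= K by rewrite divr_ge0 ?addr_ge0 ?ltW.
have mv n : measurable_fun setT (v n) by case: (Vv n).
have Vd n m := V_sub (Vv n) (Vv m).
have Wle n m : (n <= m)%N ->
    (wsq mu \1_Omega (fun x => v n x - v m x)%R <= (K * 16^-1 ^+ n)%:E)%E.
  move=> nm; rewrite (wsqE mO O0 ((VP _).1 (Vd n m)).1).
  rewrite lee_fin; apply: le_trans (energy_coercive (Vd n m)) _.
  by apply: ler_wpM2l => //; exact: vcauchy.
have Dle n m : (n <= m)%N -> (wsq pi kform
    (fun z => increment (v n) z - increment (v m) z)%R <= (1 * 16^-1 ^+ n)%:E)%E.
  move=> nm; rewrite -increment_sub (wsqE ms kform_ge0); last first.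
    exact: ((VP _).1 (Vd n m)).2.
  rewrite lee_fin mul1r; apply: le_trans (vcauchy _ _ nm).
  by rewrite lerDl -expr2 sqr_ge0.
(* The upper limit is measurable whether or not the sequence converges; [fine]
   sends infinite values to 0. *)
pose u x := fine (limn_esup (fun n => (v n x)%:E)).
have u_lim x : cvgn (fun n => v n x) -> v n x @[n --> \oo] --> u x.
  move=> /cvg_ex[l vl]; suff -> : u x = l by [].
  rewrite /u; have /cvg_limn_einf_sup[_ ->] // : (v n x)%:E @[n --> \oo] --> l%:E.
  by apply: cvg_EFin => //; near=> n.
have mu_ : measurable_fun setT u.
  apply: measurableT_comp; first exact: fine_measurable.
  by apply: measurable_fun_limn_esup => n; exact/measurable_EFinP.
have W_cvg : {ae mu, forall x, \1_Omega x = 0 :> R \/ v n x @[n --> \oo] --> u x}.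
  have := @wL2_fast_cauchy_cvg _ _ _ mu \1_Omega mO O0 v K mv.
  have h n : (wsq mu \1_Omega (fun x => v n.+1 x - v n x)%R <= (K * 16^-1 ^+ n)%:E)%E.
    by rewrite wsq_subC; exact: Wle.
  by move=> /(_ h); apply: filterS => x [|/u_lim]; [left|right].
have D_cvg : {ae pi, forall z, kform z = 0 \/
    increment (v n) z @[n --> \oo] --> increment u z}.
  have := @wL2_fast_cauchy_cvg _ _ _ pi kform ms kform_ge0
    (fun n => increment (v n)) 1 (fun n => measurable_increment (mv n)).
  have h n : (wsq pi kform (fun z => increment (v n.+1) z - increment (v n) z)%R
      <= (1 * 16^-1 ^+ n)%:E)%E by rewrite wsq_subC; exact: Dle.
  move=> /(_ h); have := ae_prod_fst mu W_cvg; apply: filterS2 => z.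
  move=> [Oz _|v1]; [left|move=> [|vz]; [by left|right]].
    by rewrite /kform /kin /kout Oz !mul0r mulr0 addr0.
  (* The second point may lie outside [Omega], where only increments are controlled; its values are
     recovered from those at the first point. *)
  have v2 : v n z.2 @[n --> \oo] --> u z.2.
    apply: u_lim; rewrite (_ : (fun n => v n z.2) =
      (fun n => v n z.1 - increment (v n) z)); last first.
      by apply/funext => n; rewrite /increment; ring.
    by apply: is_cvgB => //; apply/cvg_ex; exists (u z.1).
  by apply: cvgB.
(* Fatou with [n] fixed and the later index tending to infinity carries the Cauchy bounds over to
   the limit. *)
have Wu n : (wsq mu \1_Omega (fun x => v n x - u x)%R <= (K * 16^-1 ^+ n)%:E)%E.
  apply: (wsq_fatou mO O0 mv mu_ (mv n) W_cvg).
  by exists n => // m /= nm; exact: Wle.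
have Du n : (wsq pi kform (fun z => increment (v n) z - increment u z)%R
    <= (1 * 16^-1 ^+ n)%:E)%E.
  apply: (wsq_fatou ms kform_ge0 (fun n => measurable_increment (mv n))
    (measurable_increment mu_) (measurable_increment (mv n)) D_cvg).
  by exists n => // m /= nm; exact: Dle.
have Vu n : V Omega gamma (fun x => v n x - u x).
  apply/VP; split; split.
  - exact: measurable_funB.
  - exact: le_lt_trans (Wu n) (ltry _).
  - by apply: measurable_increment; exact: measurable_funB.
  - by rewrite increment_sub; exact: le_lt_trans (Du n) (ltry _).
exists u.
  have := V_sub (Vv 0%N) (Vu 0%N).
  by rewrite (_ : (fun x => _ - _) = u)//; apply/funext => x; ring.
(* The energy contributes the 1; Cauchy-Schwarz against the constant 1 bounds the squared mass and
   contributes [K * vol]. *)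
have bound n : 0 <= form (fun x => v n x - u x) (fun x => v n x - u x) <=
    (1 + K * vol) * 16^-1 ^+ n.
  have [W D] := (VP _).1 (Vu n).
  apply/andP; split; first by rewrite addr_ge0 ?energy_ge0// -expr2 sqr_ge0.
  rewrite mulrDl; apply: lerD.
    by rewrite -lee_fin /energy -(wsqE ms kform_ge0 D) increment_sub.
  rewrite -expr2; apply: le_trans (wform_cauchy_schwarz mO O0 W wL2_one) _.
  rewrite mulrAC; apply: ler_wpM2r; first exact: ltW.
  by rewrite -lee_fin -(wsqE mO O0 W).
apply: (@squeeze_cvgr _ _ _ _ (cst 0) (fun n => (1 + K * vol) * 16^-1 ^+ n)).
- by near=> n; exact: bound.
- exact: cvg_cst.
rewrite -(mulr0 (1 + K * vol)); apply: cvgMr; apply: cvg_expr.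
by rewrite ger0_norm ?invr_ge0// invf_lt1// ltr1n.
Unshelve. all: by end_near.
Qed.

(** * Existence and uniqueness of weak solutions *)

Variable f : Rd R d -> R.
Hypothesis f_L2 : L2 Omega f.
Hypothesis f_mean0 : (\int[mu]_(x in Omega) (f x)%:E = 0)%E.

(** [f] is measurable on [Omega] only, whereas [wL2] asks for measurability on the whole space;
    hence the extension by 0. *)
Let load v := wform mu \1_Omega (f \_ Omega) v.

Let f_wL2 : wL2 mu \1_Omega (f \_ Omega).
Proof.
have [mf foo] := f_L2; split; first by apply/(measurable_restrictT _ mOmega).
apply: le_lt_trans foo; rewrite integral_setE le_eqVlt; apply/orP; left; apply/eqP.
apply: eq_integral => x _; rewrite patchE indicE.
by case: ifP => _; rewrite ?mulr1 ?mulr0.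
Qed.

Lemma loadE v : V Omega gamma v ->
  (\int[mu]_(x in Omega) (f x * v x)%:E = (load v)%:E)%E.
Proof.
move=> /VP[Wv _]; rewrite /load /wform /Rintegral fineK; last first.
  exact: integrable_fin_num (wL2_integrable measurable_indic_Omega
    indic_Omega_ge0 f_wL2 Wv).
rewrite integral_setE; apply: eq_integral => x _; rewrite patchE indicE.
by case: ifP => _; rewrite ?mulr1 ?mulr0.
Qed.

Lemma weak_solution_exists : exists u, weak_solution Omega gamma f u.
Proof.
have mO := measurable_indic_Omega; have O0 := indic_Omega_ge0.
have Wmu v : V Omega gamma v -> wL2 mu \1_Omega v by move=> /VP[].
have V0 : V Omega gamma (0 : E).
  have := V_sub V_one V_one.
  by rewrite (_ : (fun x => _ - _) = 0)//; apply/funext => x; rewrite subrr.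
have formC u v : V Omega gamma u -> V Omega gamma v -> form u v = form v u.
  by move=> _ _; rewrite /form /energy wformC [mass u * _]mulrC.
have formZD t u v w : V Omega gamma u -> V Omega gamma v -> V Omega gamma w ->
    form (t *: (u : E) + v) w = t * form u w + form v w.
  move=> Vu Vv Vw; rewrite /form (energyZD t Vu Vv Vw) (massZD t Vu Vv); ring.
have form_ge0 u : V Omega gamma u -> 0 <= form u u.
  by move=> Vu; rewrite addr_ge0 ?energy_ge0// -expr2 sqr_ge0.
have loadZD t u v : V Omega gamma u -> V Omega gamma v ->
    load (t *: (u : E) + v) = t * load u + load v.
  move=> /Wmu Wu /Wmu Wv; rewrite /load wformC (wformZD mO O0 t Wu Wv f_wL2).
  by rewrite wformC [wform _ _ v _]wformC.
(* The squared norm of [f] times the coercivity constant, from Cauchy-Schwarz followed by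
   [energy_coercive]. *)
pose K := load (f \_ Omega) * ((C + 1) / vol).
have load_bounded v : V Omega gamma v -> load v ^+ 2 <= K * form v v.
  move=> Vv; apply: le_trans (wform_cauchy_schwarz mO O0 f_wL2 (Wmu _ Vv)) _.
  rewrite /K -mulrA; apply: ler_wpM2l; last exact: energy_coercive.
  exact: (wform_ge0 mO O0 f_wL2).
have [u Vu uP] := @bounded_functional_representation R E (V Omega gamma) form
  V0 (fun t u v => @V_ZD t u v) formC formZD form_ge0 load K loadZD load_bounded
  V_complete.
exists u; split => // v Vv; rewrite loadE// bilinE//; congr EFin.
(* The form exceeds the energy by [mass u * mass v]. Constants have zero energy, so testing with 1
   isolates [mass u * vol]. *)
suff u0 : mass u = 0 by rewrite uP// /form u0 mul0r addr0.
have load1 : load (cst 1) = 0.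
  have := loadE V_one; under eq_integral do rewrite /= mulr1.
  by rewrite f_mean0 => -[].
have : form u (cst 1) = mass u * vol.
  rewrite /form /energy (_ : increment (cst 1) = fun=> 0); last first.
    by apply/funext => z; rewrite /increment subrr.
  rewrite /wform; under eq_Rintegral do rewrite mulr0 mul0r.
  by rewrite Rintegral_cst// mul0r add0r.
rewrite -(uP _ V_one) load1 => /esym/eqP; rewrite mulf_eq0 (gt_eqF vol_gt0) orbF.
by move/eqP.
Qed.

Lemma weak_solution_unique u1 u2 : weak_solution Omega gamma f u1 ->
  weak_solution Omega gamma f u2 ->
  exists c : R, eqV Omega gamma u1 (fun x => u2 x + c).
Proof.
move=> [V1 s1] [V2 s2]; have Vw := V_sub V1 V2.
(* The difference is itself a test function, and both solutions have the same energy against it; its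
   own energy is therefore 0. *)
have eq : energy u2 (fun x => u1 x - u2 x) = energy u1 (fun x => u1 x - u2 x).
  have := s1 _ Vw.
  by rewrite (s2 _ Vw) (bilinE V1 Vw) (bilinE V2 Vw) => -[].
have [|c cP] := energy0_constant Vw.
  have := energyZD (- 1) V2 V1 Vw; rewrite eq mulN1r addNr => <-.
  by congr energy; apply/funext => x; ring.
by exists c; apply: filterS cP => x /[apply] <-; ring.
Qed.

End nonlocal_form.

(** * Domains of measure zero *)

Section null_domain.
Variables (R : realType) (d : nat) (Omega : set (Rd R d)).
Local Notation mu := (@lebesgue R d).
Hypotheses (mOmega : measurable Omega) (Omega0 : mu Omega = 0%E).

Lemma integral_null_domain (h : Rd R d -> \bar R) :
  (\int[mu]_(x in Omega) h x = 0)%E.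
Proof.
rewrite (ae_eq_integral_any (g := cst 0%E)) ?integral0//.
by exists Omega; split => // x /= nx; apply: contrapT => nOx; exact: nx.
Qed.

Lemma Gamma_null_domain gamma : Gamma Omega gamma = set0.
Proof.
by apply/seteqP; split => // y [_]; rewrite integral_null_domain ltxx.
Qed.

Lemma weak_solution_null_domain gamma f : weak_solution Omega gamma f (cst 0).
Proof.
split=> [|v _]; first by split => //; rewrite /normV2 !integral_null_domain adde0.
by rewrite /bilin !integral_null_domain mule0 adde0.
Qed.

Lemma eqV_null_domain gamma u v : eqV Omega gamma u v.
Proof.
rewrite /eqV Gamma_null_domain setU0; exists Omega; split => // x /= nx.
by apply: contrapT => nOx; exact: nx.
Qed.

End null_domain.

Theorem theorem3p5 (R : realType) (d : nat) (Omega : set (Rd R d))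
    (f : Rd R d -> R) (gamma : Rd R d -> Rd R d -> R)
    (Omega_bounded : bounded_set Omega)
    (Omega_neq0 : Omega !=set0)
    (Omega_open : open Omega)
    (f_L2 : L2 Omega f)
    (gamma_ge0 : forall x y, 0 <= gamma x y)
    (gamma_meas : kernel_measurable gamma)
    (gamma_sym : forall x y, gamma x y = gamma y x)
    (f_mean0 : (\int[@lebesgue R d]_(x in Omega) (f x)%:E = 0)%E)
    (poincare : exists2 C : R, 0 < C &
       forall v, V Omega gamma v ->
         (\int[@lebesgue R d]_(x in Omega) \int[@lebesgue R d]_(y in Omega)
            ((v x - v y) ^+ 2)%:E
          <= C%:E * \int[@lebesgue R d]_(x in Omega) \int[@lebesgue R d]_y
            ((v x - v y) ^+ 2 * gamma y x)%:E)%E) :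
  (exists u, weak_solution Omega gamma f u) /\
  (forall u1 u2, weak_solution Omega gamma f u1 ->
     weak_solution Omega gamma f u2 ->
     exists c : R, eqV Omega gamma u1 (fun x => u2 x + c)).
Proof.
have mOmega := open_measurable_Rd Omega_open.
have Omega_fin := lebesgue_bounded_lty Omega_bounded.
(* The coercivity constant divides by the volume of [Omega], hence the case distinction. Over a null
   [Omega] all integrals vanish, [Gamma] is empty and any two functions are identified. *)
have [null|nonnull] := eqVneq (@lebesgue R d Omega) 0%E.
  split; first by exists (cst 0); exact: weak_solution_null_domain.
  by move=> u1 u2 _ _; exists 0; exact: eqV_null_domain.
have [Z [mZ Z0 mgZ]] := kernel_measurable_pair gamma_meas gamma_ge0.
have [C C_gt0 poincareC] := poincare.
have vol_gt0 : 0 < vol Omega.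
  by rewrite -lte_fin -volE// lt_def nonnull measure_ge0.
split.
  exact: (weak_solution_exists mOmega gamma_ge0 gamma_sym mZ Z0 mgZ Omega_fin
    C_gt0 poincareC vol_gt0 f_L2 f_mean0).
move=> u1 u2.
exact: (weak_solution_unique mOmega gamma_ge0 gamma_sym mZ Z0 mgZ Omega_fin
    C_gt0 poincareC vol_gt0).
Qed.
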